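(* Fix $n\ge 2$, $r_0>0$ and $\omega_0\in(0,1)$. For any $\alpha_0>0$, any integer $k\ge\lceil c_{\alpha_0}\rceil+1$ and any $0<\gamma<\omega_0$, so that $\omega:=\omega_0-\gamma>0$, there exists $0<\varepsilon<\frac{1}{2R_{\alpha_0}}$ with the following property. For all $T_0>0$ satisfying $0<\frac{T_0}{r_0}<\varepsilon$ and all $\kappa_0\in\mathbb R$, there exists a (three-parameter, with parameters $\alpha_0,\kappa_0,T_0$) family of smooth solutions to $$v_{tt}-\Delta v=|\nabla_x v|^2,$$ arising from smooth initial data, well-defined in $\mathcal A_{R_{\alpha_0}}(r_0,T_0)$, given by $$v^{(n)}_{\alpha_0,\kappa_0,T_0}(x,t)=-\alpha_0\log\Bigl(1-\frac{t}{T_0}\Bigr)-\alpha_0\log\Bigl(\sqrt{1+\alpha_0}+\frac{|x|-r_0}{T_0-t}\Bigr)-\frac{n-1}{2}\log\Bigl(\frac{|x|}{r_0}\Bigr)+\zeta^{(n)}_{\alpha_0,T_0}(|x|,t)+\kappa_0,$$ where the correction $\zeta_{\alpha_0,T_0}=\zeta^{(n)}_{\alpha_0,T_0}(r,t)$ satisfies, for all $t\in[0,T_0)$, $$(T_0-t)^{-\frac12+j}\,\|\partial_r^j\zeta_{\alpha_0,T_0}(\cdot,t)\|_{L^2(B_{R_{\alpha_0}(T_0-t)}(r_0))}\lesssim\Bigl(\frac{T_0}{r_0}\Bigr)^2\Bigl(1-\frac{t}{T_0}\Bigr)^{\omega},\qquad j=0,\dots,k+1,$$ $$(T_0-t)^{\frac12+j}\,\|\partial_r^j\partial_t\zeta_{\alpha_0,T_0}(\cdot,t)\|_{L^2(B_{R_{\alpha_0}(T_0-t)}(r_0))}\lesssim\Bigl(\frac{T_0}{r_0}\Bigr)^2\Bigl(1-\frac{t}{T_0}\Bigr)^{\omega},\qquad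 j=0,\dots,k.$$ Finally, if $n=3$, then $\zeta^{(3)}_{\alpha_0,T_0}\equiv 0$ provides a closed-form family of solutions $$v^{(3)}_{\alpha_0,\kappa_0,T_0}(x,t)=-\alpha_0\log\Bigl(1-\frac{t}{T_0}\Bigr)-\alpha_0\log\Bigl(\sqrt{1+\alpha_0}+\frac{|x|-r_0}{T_0-t}\Bigr)-\log\Bigl(\frac{|x|}{r_0}\Bigr)+\kappa_0,$$ smooth in $\mathcal A_1(r_0,T_0)$ whenever $\frac{T_0}{r_0}<1$.
   Context: For $\alpha_0>0$ set $$R_{\alpha_0}=\frac{1+\sqrt{1+\alpha_0}}{2},\qquad \delta_0=\min\Bigl\{1,\frac{\alpha_0}{4}\Bigr\},\qquad c_{\alpha_0}=\frac{\alpha_0+\delta_0}{\sqrt{1+\alpha_0-\delta_0}-\frac{1+\sqrt{1+\alpha_0}}{2}}.$$ For $r_0>0$, $T>0$, $R\ge1$, $$\mathcal A_R(r_0,T)=\{(x,t)\in\mathbb R^n\times[0,T):\ \bigl||x|-r_0\bigr|\le R(T-t)\}.$$ $B_\rho(r_0)=(r_0-\rho,r_0+\rho)\subset\mathbb R$ denotes the open interval in the radial variable $r=|x|$. $\lceil c\rceil$ is the smallest integer $\ge c$. The notation $a\lesssim b$ means $a\le Cb$ with a constant $C>0$ depending only on $n,k,\omega_0,\gamma,\alpha_0$ (in particular independent of $t$, $T_0$, $r_0$, $\kappa_0$). The function $\zeta^{(n)}_{\alpha_0,T_0}$ does not depend on $\kappa_0$. *)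

(* Defs.v *)
From mathcomp Require Import all_boot all_order all_algebra.
From mathcomp Require Import all_classical all_reals all_analysis.

Set Implicit Arguments.
Unset Strict Implicit.
Unset Printing Implicit Defensive.
Import Order.TTheory GRing.Theory Num.Theory.
Import numFieldNormedType.Exports.
Local Open Scope classical_set_scope.
Local Open Scope ring_scope.

(* The library norm on ['rV[R]_n] is the sup norm; this is the Euclidean one. *)
Definition enorm (R : realType) (n : nat) (x : 'rV[R]_n) : R :=
  Num.sqrt (\sum_(i < n) x ord0 i ^+ 2).

Fixpoint iter_derive (R : realType) (V : normedModType R) (s : seq V)
    (f : V -> R) : V -> R :=
  if s is v :: s' then 'D_v (iter_derive s' f) else f.

Definition smooth_on_open (R : realType) (V : normedModType R) (U : set V)
    (f : V -> R) : Prop :=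
  forall (s : seq V) (x : V), U x ->
    {for x, continuous (iter_derive s f)} /\
    (forall v : V, derivable (iter_derive s f) x v).

(* C^oo on a set that need not be open: smooth on some open neighbourhood.  In
   particular, smoothness on [cone] below is smoothness up to and including the
   initial time t = 0 and the lateral boundary. *)
Definition smooth_on (R : realType) (V : normedModType R) (A : set V)
    (f : V -> R) : Prop :=
  exists U : set V, [/\ open U, A `<=` U & smooth_on_open U f].

(* Space-time is ['rV[R]_n * R], with points (x, t). *)
Section space_time.
Variables (R : realType) (n : nat).
Implicit Types (v : 'rV[R]_n * R -> R) (A : set ('rV[R]_n * R)).

Definition dt v : 'rV[R]_n * R -> R := 'D_((0, 1) : 'rV[R]_n * R) v.

Definition dx (i : 'I_n) v : 'rV[R]_n * R -> R :=
  'D_((delta_mx ord0 i, 0) : 'rV[R]_n * R) v.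

Definition laplacian v (p : 'rV[R]_n * R) : R :=
  \sum_(i < n) dx i (dx i v) p.

Definition grad_sq v (p : 'rV[R]_n * R) : R := \sum_(i < n) dx i v p ^+ 2.

Definition smooth_solution_on A v : Prop :=
  smooth_on A v /\
  (forall p, A p -> dt (dt v) p - laplacian v p = grad_sq v p).

Definition smooth_initial_data_on A v : Prop :=
  smooth_on [set x | A (x, 0)] (fun x => v (x, 0)) /\
  smooth_on [set x | A (x, 0)] (fun x => dt v (x, 0)).

Definition cone (rad r0 T : R) : set ('rV[R]_n * R) :=
  [set p | 0 <= p.2 < T /\ `|enorm p.1 - r0| <= rad * (T - p.2)].

Definition blowup_sol (alpha0 kappa0 T0 r0 : R) (zeta : R -> R -> R)
    (p : 'rV[R]_n * R) : R :=
  - alpha0 * ln (1 - p.2 / T0)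
  - alpha0 * ln (Num.sqrt (1 + alpha0) + (enorm p.1 - r0) / (T0 - p.2))
  - (n%:R - 1) / 2 * ln (enorm p.1 / r0)
  + zeta (enorm p.1) p.2 + kappa0.

(* [ln] is total, with value 0 on nonpositive reals: this states that the three
   logarithms in [blowup_sol] are genuinely defined on [A]. *)
Definition well_defined_on A (alpha0 T0 r0 : R) : Prop :=
  forall p, A p ->
    [/\ 0 < 1 - p.2 / T0,
        0 < Num.sqrt (1 + alpha0) + (enorm p.1 - r0) / (T0 - p.2) &
        0 < enorm p.1 / r0].

End space_time.

Section parameters.
Variable R : realType.

Definition Ralpha (alpha0 : R) : R := (1 + Num.sqrt (1 + alpha0)) / 2.

Definition delta0 (alpha0 : R) : R := Num.min 1 (alpha0 / 4).

Definition calpha (alpha0 : R) : R :=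
  (alpha0 + delta0 alpha0) /
  (Num.sqrt (1 + alpha0 - delta0 alpha0) - (1 + Num.sqrt (1 + alpha0)) / 2).

Definition L2norm (D : set R) (f : R -> R) : \bar R :=
  Lnorm (@lebesgue_measure R) 2%:E (fun r => (f r * \1_D r)%:E).

(* B_rho(r0), an interval in the radial variable *)
Definition rball (r0 rho : R) : set R := `]r0 - rho, r0 + rho[.

Definition dr_iter (j : nat) (zeta : R -> R -> R) (r t : R) : R :=
  derive1n j (fun r' => zeta r' t) r.

Definition dt_radial (zeta : R -> R -> R) (r t : R) : R :=
  derive1 (fun t' => zeta r t') t.

End parameters.

(* Main.v *)
Require Import Defs.
From mathcomp Require Import all_boot all_order all_algebra.
From mathcomp Require Import all_classical all_reals all_analysis.
From mathcomp Require Import ring lra.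

Set Implicit Arguments.
Unset Strict Implicit.
Unset Printing Implicit Defensive.
Import Order.TTheory GRing.Theory Num.Theory.
Import numFieldNormedType.Exports.
Local Open Scope classical_set_scope.
Local Open Scope ring_scope.

(** Put [b = sqrt (1 + alpha0)] and [s = b (T0 - t) + (r - r0)]. For a radial
    [v], the substitution [v = w - (n-1)/2 log (r / r0)] turns the equation
    into [w_tt - w_rr - w_r^2 = - m / r^2] with [m = (n-1)(n-3)/4], and
    [- alpha0 log s] solves it when [m = 0], that is for [n = 3].

    For other dimensions the forcing [m / r^2] is invariant under the
    dilations of the [(r, t)]-plane about the point of the singular line
    [s = 0] where [r = 0]. It is thus consistent to look for a correction
    [zeta (r, t) = f (sigma)] that depends only on [sigma = s / r], and the
    wave equation becomes an ordinary one. It involves only [g = f'], and it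
    is a Riccati equation with a regular singular point at [sigma = 0]:
    [x P g' + 2 (1-x) (x+alpha0) g - x (1-x)^2 g^2 + m x = 0], with
    [P = alpha0 + 2 x - x^2]. The quotient [g = - x chi / phi] linearises it,
    and the resulting linear system has a power series solution whose
    coefficients grow at most geometrically ([linear_system_solution]). Hence
    [g] is smooth near [0] with [g 0 = 0], and its primitive [f] vanishes to
    second order ([correction_profile]).

    In the cone, [sigma] is positive and at most a multiple of
    [(T0 - t) / r0]. A radial derivative of order [j] of [zeta] is [r^-j]
    times a smooth function of [sigma] ([derive1n_profile]), and each
    derivative costs at most one order of vanishing ([profile_dr_order]). So
    [(T0 - t)^j] times that derivative is bounded by a constant times
    [((T0 - t) / r0)^2], uniformly on the cone ([pointwise_decay]). This
    square equals [(T0 / r0)^2 (1 - t / T0)^2], and [omega < 1] makes it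
    at most the required rate. The threshold [epsilon] keeps the cone
    away from [r = 0] and [sigma] inside the interval where [f] is defined
    and the bounds hold.

    Smoothness and the equation hold on the open set [sol_dom], which
    contains the closed cone ([blowup_sol_solves]); the closed-form solution
    in dimension [3] is the case [f = 0]. *)

(** * Smoothness along directions *)

Section directional_derivatives.
Variables (R : realType) (V : normedModType R).
Implicit Types (x v : V) (f g : V -> R) (h : R -> R) (U : set V).

(** The chain rule for directional derivatives reduces to one real variable
    through this equivalence, without any Frechet differentiability. *)
Lemma is_derive_line f x v (d : R) :
  is_derive x v f d <-> is_derive (0 : R) 1 (fun k : R => f (k *: v + x)) d.
Proof.
have E : 'D_v f x = 'D_1 (fun k : R => f (k *: v + x)) 0.
  rewrite /derive; set g1 := fun k => k^-1 *: _; set g2 := fun k => k^-1 *: _.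
  suff -> : g1 = g2 by [].
  by apply/funext => k; rewrite /g1 /g2 /= addr0 scale0r add0r [_%:A]mulr1.
split => -[dfx dE]; apply: DeriveDef.
- exact: (derivable1P _ _ _).1 dfx.
- by rewrite -E.
- exact: (derivable1P _ _ _).2 dfx.
- by rewrite E.
Qed.

Lemma is_derive_comp1 h g x v (dh dg : R) :
  is_derive (g x) 1 h dh -> is_derive x v g dg ->
  is_derive x v (h \o g) (dh * dg).
Proof.
move=> Dh /is_derive_line Dg; apply/is_derive_line.
by apply: (@is_derive1_comp _ h (fun k : R => g (k *: v + x))) => //=;
  rewrite scale0r add0r.
Qed.

(** Regularity of order [m], peeled off from the innermost direction: in this
    form the Leibniz and chain rules prove closure properties by induction on
    [m], whereas [smooth_on_open] adds new directions on the outside. *)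
Fixpoint Cn (m : nat) U f : Prop :=
  (forall x, U x -> {for x, continuous f} /\ forall v, derivable f x v) /\
  (if m is m'.+1 then forall v, Cn m' U ('D_v f) else True).

Lemma iter_derive_rcons s v f :
  iter_derive (rcons s v) f = iter_derive s ('D_v f).
Proof. by elim: s => //= w s ->. Qed.

Lemma smooth_on_openP U f : smooth_on_open U f <-> forall m, Cn m U f.
Proof.
split=> [sf m|sf s].
  elim: m f sf => [|m IH] f sf /=; first by split=> // x Ux; exact: (sf [::]).
  split=> [x Ux|v]; first exact: (sf [::]).
  by apply: IH => s x Ux; rewrite -iter_derive_rcons; exact: sf.
have [m] := ubnP (size s); elim: m s f {sf}(sf m) => // m IH s f.
case/lastP: s => [[cf _] _ x Ux|s v [_ sf]]; first exact: cf.
by rewrite size_rcons iter_derive_rcons ltnS; exact: IH (sf v).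
Qed.

Lemma CnW m U f : Cn m.+1 U f -> Cn m U f.
Proof.
elim: m f => [|m IH] f [cf sf]; first by split.
by split => // v; exact/IH/sf.
Qed.

Lemma Cn_sub m U U' f : U' `<=` U -> Cn m U f -> Cn m U' f.
Proof.
move=> UU'; elim: m f => [|m IH] f [cf sf]; first by split=> // x /UU'; exact: cf.
by split=> [x /UU'|v]; [exact: cf|exact: IH (sf v)].
Qed.

Lemma derive_eq_open U f g v : open U -> {in U, f =1 g} ->
  {in U, 'D_v f =1 'D_v g}.
Proof.
move=> oU fg x /set_mem Ux; apply: near_eq_derive.
near=> y; apply: fg; apply/mem_set; near: y; exact: open_nbhs_nbhs.
Unshelve. all: by end_near. Qed.

Lemma Cn_eq m U f g : open U -> {in U, f =1 g} -> Cn m U f -> Cn m U g.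
Proof.
move=> oU; elim: m f g => [|m IH] f g fg Cf; have [cf sf] := Cf.
all: have cg x (Ux : U x) : {for x, continuous g} /\ forall v, derivable g x v.
1,3: have [cfx dfx] := cf x Ux.
1,2: have nfg : {near x, f =1 g}.
1,3: near=> y; apply: fg; apply/mem_set; near: y; exact: open_nbhs_nbhs.
1,2: split=> [|v]; last exact: near_eq_derivable nfg (dfx v).
1,2: suff: g @ x --> f x by rewrite (fg x) //; exact/mem_set.
1,2: by apply: cvg_trans cfx; apply: near_eq_cvg.
  by [].
by split=> // v; apply: IH (sf v); exact: derive_eq_open.
Unshelve. all: by end_near. Qed.

(** A formula for the derivatives that is valid on [U] only is enough,
    because derivatives depend on germs and [U] is open. *)
Lemma Cn_is_derive U m f g : open U ->
  (forall x, U x -> {for x, continuous f}) ->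
  (forall v, exists2 df : V -> R,
      (forall x, U x -> is_derive x v f (df x)) & Cn m U df) ->
  Cn m.+1 U f.
Proof.
move=> oU cf df; split=> [x Ux|v].
  split; first exact: cf.
  by move=> v; have [d /(_ x Ux)[]] := df v.
have [d dP] := df v; apply: Cn_eq => // x /set_mem Ux.
by have /= [_ ->] := dP x Ux.
Qed.

End directional_derivatives.

(** * Closure properties of smooth functions *)

Section smooth_closure.
Variables (R : realType) (V : normedModType R).
Implicit Types (x v : V) (f g : V -> R) (h : R -> R) (U : set V).

Lemma Cn_continuous m U f x : Cn m U f -> U x -> {for x, continuous f}.
Proof. by case: m => [|m] [cf _] Ux; have [] := cf x Ux. Qed.

Lemma Cn_is_derive_at m U f x v : Cn m U f -> U x -> is_derive x v f ('D_v f x).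
Proof.
by case: m => [|m] [cf _] Ux; apply: DeriveDef => //; have [] := cf x Ux.
Qed.

Lemma Cn_cst m U (c : R) : open U -> Cn m U (fun=> c).
Proof.
elim: m c => [|m IH] c oU.
  by split=> // x _; split; [exact: cvg_cst|move=> v; exact: derivable_cst].
apply: Cn_is_derive => // [x _|v]; first exact: cvg_cst.
by exists (fun=> 0); [move=> x _; exact: is_derive_cst|exact: IH].
Qed.

Lemma CnD m U f g : open U -> Cn m U f -> Cn m U g -> Cn m U (fun x => f x + g x).
Proof.
move=> oU; elim: m f g => [|m IH] f g [cf sf] [cg sg].
  split=> // x Ux; have [? df] := cf x Ux; have [? dg] := cg x Ux.
  by split; [exact: cvgD|move=> v; exact: derivableD].
apply: Cn_is_derive => // [x Ux|v].
  by apply: cvgD; [case: (cf x Ux)|case: (cg x Ux)].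
exists (fun x => 'D_v f x + 'D_v g x); last exact: IH (sf v) (sg v).
move=> x Ux; have [? df] := cf x Ux; have [? dg] := cg x Ux.
by apply: is_deriveD; exact: DeriveDef.
Qed.

Lemma CnM m U f g : open U -> Cn m U f -> Cn m U g -> Cn m U (fun x => f x * g x).
Proof.
move=> oU; elim: m f g => [|m IH] f g Cf Cg; have [cf sf] := Cf; have [cg sg] := Cg.
  split=> // x Ux; have [? df] := cf x Ux; have [? dg] := cg x Ux.
  by split; [exact: cvgM|move=> v; exact: derivableM].
apply: Cn_is_derive => // [x Ux|v].
  by apply: cvgM; [case: (cf x Ux)|case: (cg x Ux)].
exists (fun x => f x * 'D_v g x + g x * 'D_v f x).
  move=> x Ux; have [? df] := cf x Ux; have [? dg] := cg x Ux.
  by apply: is_deriveM; exact: DeriveDef.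
by apply: CnD => //; [exact: IH (CnW Cf) (sg v)|exact: IH (CnW Cg) (sf v)].
Qed.

Lemma CnN m U f : open U -> Cn m U f -> Cn m U (fun x => - f x).
Proof.
move=> oU Cf; apply: (Cn_eq oU) (CnM oU (Cn_cst m (-1) oU) Cf) => x _.
by rewrite mulN1r.
Qed.

Lemma Cn_comp1 m U (W : set R) h g : open U ->
  (forall x, U x -> W (g x)) -> Cn m W h -> Cn m U g -> Cn m U (fun x => h (g x)).
Proof.
move=> oU UW; elim: m h => [|m IH] h Ch Cg.
  split=> // x Ux; have [cg _] := Cg; have [gx dg] := cg x Ux.
  have [ch _] := Ch; have [hx dh] := ch _ (UW x Ux).
  split; first exact: continuous_comp.
  by move=> v; have [] := is_derive_comp1 (derivableP (dh 1)) (derivableP (dg v)).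
have [cg dg] := Cg; have [ch dh] := Ch.
apply: Cn_is_derive => // [x Ux|v].
  by apply: continuous_comp; [case: (cg x Ux)|case: (ch _ (UW x Ux))].
exists (fun x => 'D_1 h (g x) * 'D_v g x).
  move=> x Ux; apply: is_derive_comp1; apply: derivableP.
    by have [_] := ch _ (UW x Ux); exact.
  by have [_] := cg x Ux; exact.
by apply: CnM => //; [exact: IH (dh 1) (CnW Cg)|exact: dg].
Qed.

End smooth_closure.

Section smooth_real_functions.
Variable R : realType.
Implicit Types (f g : R -> R) (U : set R).

Lemma Cn_real m U f (df : R -> R) : open U ->
  (forall x, U x -> is_derive x 1 f (df x)) -> Cn m U df -> Cn m.+1 U f.
Proof.
move=> oU Df Cdf; apply: Cn_is_derive => // [x /Df[fx1 _]|v].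
  exact/differentiable_continuous/derivable1_diffP.
exists (fun x => df x * v); last by apply: CnM => //; exact: Cn_cst.
move=> x Ux; apply/is_derive_line.
have := @is_derive_comp1 _ R f (fun k : R => k *: v + x) 0 1 (df x) v.
apply; first by rewrite scale0r add0r; exact: Df.
rewrite (_ : (fun k : R => _) = (id * cst v + cst x)) //.
by apply: is_derive_eq; rewrite /= scaler0 add0r addr0 [_ *: _]mulr1.
Qed.

Lemma Cn_id m U : open U -> Cn m U (@idfun R).
Proof.
by move=> oU; apply: CnW; apply: (Cn_real oU _ (Cn_cst m 1 oU)).
Qed.

Lemma Cn_inv m : Cn m [set x : R | x != 0] GRing.inv.
Proof.
have oU : open [set x : R | x != 0] by exact: open_neq.
have D (x : R) : x != 0 -> is_derive x 1 (@GRing.inv R) (- (x^-1 * x^-1)).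
  move=> x0; apply: is_derive_eq; first exact: (@is_deriveV _ idfun x 1 1).
  by rewrite /= [_ *: _]mulr1 expr2 invfM.
elim: m => [|m IH].
  split=> // x x0; split; first exact: inv_continuous.
  by move=> v; apply: derivableV => //; exact: derivable_id.
by apply: (Cn_real oU) => //; apply: CnN => //; exact: CnM.
Qed.

Lemma Cn_ln m : Cn m [set x : R | 0 < x] (@ln R).
Proof.
have oU : open [set x : R | 0 < x] by exact: open_gt.
have CV : Cn m [set x : R | 0 < x] GRing.inv.
  by apply: (Cn_sub _ (@Cn_inv m)) => x; exact: lt0r_neq0.
by apply: CnW; apply: (Cn_real oU _ CV) => x x0; exact: is_derive1_ln.
Qed.

Lemma Cn_sqrt m : Cn m [set x : R | 0 < x] (@Num.sqrt R).
Proof.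
have oU : open [set x : R | 0 < x] by exact: open_gt.
elim: m => [|m IH].
  split=> // x x0; split; first exact: sqrt_continuous.
  have [d _] := is_derive1_sqrt x0.
  move=> v; have /derivable1_diffP dx := d; exact: diff_derivable.
apply: (Cn_real (df := fun x => 2^-1 * (Num.sqrt x)^-1)) => // [x x0|].
  by rewrite -invfM; exact: is_derive1_sqrt.
apply: CnM => //; first exact: Cn_cst.
apply: Cn_comp1 (Cn_inv m) IH => // x /= x0.
by rewrite gt_eqF // sqrtr_gt0.
Qed.

End smooth_real_functions.

Section inverse_and_logarithm.
Variables (R : realType) (V : normedModType R).
Implicit Types (h : V -> R) (x v : V) (U : set V).

Lemma Cn_inv_comp k U h : open U -> (forall x, U x -> h x != 0) ->
  Cn k U h -> Cn k U (fun x => (h x)^-1).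
Proof. by move=> oU h0; apply: (Cn_comp1 oU h0); exact: Cn_inv. Qed.

Lemma Cn_ln_comp k U h : open U -> (forall x, U x -> 0 < h x) ->
  Cn k U h -> Cn k U (fun x => ln (h x)).
Proof. by move=> oU h0; apply: (Cn_comp1 oU h0); exact: Cn_ln. Qed.

Lemma is_derive_inv_comp h x v (d : R) : h x != 0 ->
  is_derive x v h d -> is_derive x v (fun y => (h y)^-1) (- (h x) ^- 2 * d).
Proof.
move=> h0 Dh; apply: (@is_derive_comp1 _ _ GRing.inv) => //.
apply: is_derive_eq; first exact: (@is_deriveV _ idfun).
by rewrite /GRing.scale /= mulr1.
Qed.

Lemma is_derive_ln_comp h x v (d : R) : 0 < h x ->
  is_derive x v h d -> is_derive x v (fun y => ln (h y)) ((h x)^-1 * d).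
Proof. by move=> h0; apply: is_derive_comp1; exact: is_derive1_ln. Qed.

End inverse_and_logarithm.

(** * Sums of power series *)

Section power_series.
Variable R : realType.
Implicit Types (c d : R^nat) (F G : R -> R) (rho : R).

(** The sum [F] is a parameter, so that an identity between coefficient
    sequences becomes an identity between functions by uniqueness of the sum. *)
Definition psum rho c F := forall x : R, `|x| < rho -> pseries c x @ \oo --> F x.

(** The coefficients of [x * F x] when [c] are those of [F]. *)
Definition mulX c : R^nat := fun j => if j is i.+1 then c i else 0.

Lemma psum_unique rho c F G x : psum rho c F -> psum rho c G ->
  `|x| < rho -> F x = G x.
Proof. by move=> cF cG xr; apply: cvg_unique (cF x xr) (cG x xr). Qed.

Lemma psumD rho c d F G : psum rho c F -> psum rho d G ->
  psum rho (fun j => c j + d j) (fun x => F x + G x).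
Proof.
move=> cF cG x xr; rewrite (_ : pseries _ _ = pseries c x + pseries d x).
  by apply: cvgD; [exact: cF|exact: cG].
rewrite /pseries; apply/funext => n; rewrite fctE /series /= -big_split /=.
by apply: eq_bigr => i _; rewrite mulrDl.
Qed.

Lemma psumZ rho a c F : psum rho c F ->
  psum rho (fun j => a * c j) (fun x => a * F x).
Proof.
move=> cF x xr; rewrite (_ : pseries _ _ = fun n => a * pseries c x n).
  by apply: cvgM; [exact: cvg_cst|exact: cF].
rewrite /pseries; apply/funext => n; rewrite /series /= mulr_sumr.
by apply: eq_bigr => i _; rewrite mulrA.
Qed.

Lemma psumX rho c F : psum rho c F -> psum rho (mulX c) (fun x => x * F x).
Proof.
move=> cF x xr; rewrite -(cvg_shiftS (pseries _ _)).
have -> : [sequence pseries (mulX c) x n.+1]_n = (fun n => x * pseries c x n).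
  apply/funext => n; rewrite /pseries /series /=.
  rewrite big_nat_recl //= mul0r add0r mulr_sumr.
  by apply: eq_bigr => i _; rewrite exprS mulrCA.
by apply: cvgM; [exact: cvg_cst|exact: cF].
Qed.

(** Comparison with the series of [c] at a larger radius [z], using
    [(n+1) |x|^n <= (z^(n+1) - |x|^(n+1)) / (z - |x|)]. *)
Lemma cvg_pseries_diffs rho c :
  (forall x, `|x| < rho -> cvgn (pseries c x)) ->
  forall x, `|x| < rho -> cvgn (pseries (pseries_diffs c) x).
Proof.
move=> cc x xr.
pose z := (`|x| + rho) / 2; pose y := (z + rho) / 2.
have [xz zy yr] : [/\ `|x| < z, z < y & y < rho] by rewrite /y /z; split; lra.
have z0 : 0 < z by apply: le_lt_trans xz.
have y0 : 0 < y by apply: lt_trans zy.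
have cy : cvgn (pseries c y) by apply: cc; rewrite gtr0_norm.
have cz : cvgn (pseries (fun i => `|c i|) z).
  by apply: (is_cvg_pseries_inside_norm cy); rewrite !gtr0_norm.
apply: normed_cvg.
have cz' : cvgn [series (z - `|x|)^-1 * (`|c n.+1| * z ^+ n.+1)]_n.
  rewrite (_ : [series _]_n = fun N => (z - `|x|)^-1 *
      (pseries (fun i => `|c i|) z (N + 1)%N - `|c 0|)); last first.
    apply/funext => N; rewrite /pseries /series /= addn1 big_nat_recl //=.
    by rewrite expr0 mulr1 addrAC subrr add0r mulr_sumr.
  apply: is_cvgMl_tmp; apply: is_cvgB; last exact: is_cvg_cst.
  by apply/cvg_ex; exists (limn (pseries (fun i => `|c i|) z)); rewrite cvg_shiftn.
apply: series_le_cvg cz' => /= n.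
- exact: normr_ge0.
- by rewrite !mulr_ge0 ?invr_ge0 ?exprn_ge0 ?subr_ge0 ?(ltW xz) ?(ltW z0).
rewrite /pseries_diffs normrM normrM normr_nat normrX.
rewrite ler_pdivlMl ?subr_gt0 // mulrCA [_%:R * _]mulrC -!mulrA ler_wpM2l //.
have := subrXX z `|x| n.+1; set S := \sum_(i < _) _ => E.
have SE : n.+1%:R * `|x| ^+ n <= S.
  rewrite -[n.+1 in leLHS]card_ord -sumr_const mulr_suml.
  apply: ler_sum => i _; rewrite mul1r /=.
  have -> : `|x| ^+ n = `|x| ^+ (n - i) * `|x| ^+ i.
    by rewrite -exprD subnK // -ltnS.
  rewrite ler_wpM2r ?exprn_ge0 //.
  by rewrite lerXn2r ?nnegrE // ltW // (le_lt_trans _ xz).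
apply: (@le_trans _ _ ((z - `|x|) * S)).
  by rewrite mulrCA ler_pM2l ?subr_gt0.
by rewrite -E gerBl exprn_ge0.
Qed.

Lemma psum_diffs rho c F : psum rho c F ->
  exists2 F', psum rho (pseries_diffs c) F' &
    forall x : R, `|x| < rho -> is_derive x 1 F (F' x).
Proof.
move=> cF.
have cc x : `|x| < rho -> cvgn (pseries c x).
  by move=> xr; apply/cvg_ex; exists (F x); exact: cF.
have cd := cvg_pseries_diffs cc; have cdd := cvg_pseries_diffs cd.
exists (fun x => limn (pseries (pseries_diffs c) x)) => x xr; first exact: cd.
pose y := (`|x| + rho) / 2.
have xy : `|x| < y by rewrite /y; lra.
have yr : `|y| < rho by rewrite gtr0_norm ?(le_lt_trans _ xy) // /y; lra.
have D := pseries_snd_diffs (cc y yr) (cd y yr) (cdd y yr).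
have {}D := D x (lt_le_trans xy (ler_norm _)).
apply: near_eq_is_derive D; near=> u.
apply: cvg_lim => //; apply: cF; near: u.
by apply: (cvgr_lt `|x|) => //; exact: norm_continuous.
Unshelve. all: by end_near. Qed.

Lemma psum_smooth m rho c F : psum rho c F -> Cn m [set x : R | `|x| < rho] F.
Proof.
have oU : open [set x : R | `|x| < rho].
  apply: (@open_comp _ _ (fun x : R => `|x|) [set x | x < rho]) => [x _|].
    exact: norm_continuous.
  exact: open_lt.
elim: m c F => [|m IH] c F /psum_diffs[F' cF' DF]; last first.
  by apply: (Cn_real oU DF); exact: IH cF'.
split=> // x xr; have [dF _] := DF x xr; have /derivable1_diffP dF' := dF.
by split=> [|v]; [exact: differentiable_continuous|exact: diff_derivable].
Qed.

Lemma geometric_psum c (M L : R) : 0 < L -> (forall j, `|c j| <= M * L ^+ j) ->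
  psum L^-1 c (fun x => limn (pseries c x)).
Proof.
move=> L0 cL x xL; have xL1 : `|L * `|x| | < 1.
  by rewrite normrM normr_id (gtr0_norm L0) mulrC -ltr_pdivlMr // mul1r.
apply: normed_cvg.
apply: series_le_cvg (is_cvg_geometric_series (a := M) xL1) => /= n.
- exact: normr_ge0.
- rewrite mulr_ge0 ?exprn_ge0 ?(mulr_ge0 (ltW L0)) //.
  by have := cL 0; rewrite expr0 mulr1; apply: le_trans.
- by rewrite normrM normrX exprMn mulrA ler_wpM2r ?exprn_ge0.
Qed.

End power_series.

(** * A linear system with a regular singular point *)

Section linear_system.
Variable R : realType.
Variables (al m : R).
Hypothesis al0 : 0 < al.

(** Solving the system [P phi' = x (1-x)^2 chi],
    [P x chi' = - (3 al + (4 - 2 al) x - 3 x^2) chi + m phi], with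
    [P = al + 2 x - x^2], for the coefficients of order [j+1]. The state
    holds the values that the recursion looks back on: those of [phi] at [j]
    and [j-1], and those of [chi] from [j] to [j-3], the value at a negative
    index being [0]. *)
Definition next_coefs (j : nat) (s : (R * R) * (R * R * R * R)) :=
  let: ((p, p1), (c, c1, c2, c3)) := s in
  let p' := (- (2 * j%:R) * p + (j%:R - 1) * p1 + c1 - 2 * c2 + c3)
              / (al * j.+1%:R) in
  let c' := (- (2 * j%:R + 4 - 2 * al) * c + (j%:R + 2) * c1 + m * p')
              / (al * (j%:R + 4)) in
  ((p', p), (c', c, c1, c2)).

Fixpoint coefs (j : nat) : (R * R) * (R * R * R * R) :=
  if j is i.+1 then next_coefs i (coefs i)
  (* the constant term of the second equation forces chi 0 = m / (3 al) *)
  else ((1, 0), (m / (3 * al), 0, 0, 0)).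

Definition phi_coef (j : nat) : R := (coefs j).1.1.
Definition chi_coef (j : nat) : R := (coefs j).2.1.1.1.

Lemma coefsE j : coefs j =
  ((phi_coef j, mulX phi_coef j),
   (chi_coef j, mulX chi_coef j, mulX (mulX chi_coef) j,
    mulX (mulX (mulX chi_coef)) j)).
Proof.
elim: j => [|j IH] //.
have Ep : phi_coef j.+1 = (next_coefs j (coefs j)).1.1 by [].
have Ec : chi_coef j.+1 = (next_coefs j (coefs j)).2.1.1.1 by [].
by rewrite Ep Ec [LHS]/= IH.
Qed.

Lemma phi_coefS j : phi_coef j.+1 =
  (- (2 * j%:R) * phi_coef j + (j%:R - 1) * mulX phi_coef j
   + mulX chi_coef j - 2 * mulX (mulX chi_coef) j
   + mulX (mulX (mulX chi_coef)) j) / (al * j.+1%:R).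
Proof. by rewrite {1}/phi_coef /= coefsE. Qed.

Lemma chi_coefS j : chi_coef j.+1 =
  (- (2 * j%:R + 4 - 2 * al) * chi_coef j + (j%:R + 2) * mulX chi_coef j
   + m * phi_coef j.+1) / (al * (j%:R + 4)).
Proof. by rewrite {1}/chi_coef /= coefsE /= phi_coefS. Qed.

(** The coefficients of the recursion are quotients of affine functions of
    [j], so one step multiplies the size of the state by a bounded factor. *)
Definition coef_growth : R := 1 + 5 / al + (3 + 2 * al + `|m| * (5 / al)) / al.

Lemma coef_growth_ge1 : 1 <= coef_growth.
Proof.
rewrite /coef_growth -addrA lerDl addr_ge0 // divr_ge0 ?(ltW al0) //.
by rewrite !addr_ge0 ?mulr_ge0 ?invr_ge0 ?(ltW al0).
Qed.

Lemma phi_coef_step j (M : R) :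
  let s := [:: phi_coef j; mulX phi_coef j; mulX chi_coef j;
               mulX (mulX chi_coef) j; mulX (mulX (mulX chi_coef)) j] in
  all (fun u => `|u| <= M) s -> `|phi_coef j.+1| <= 5 / al * M.
Proof.
rewrite phi_coefS /= => /and5P[p0 p1 c1 c2 /andP[c3 _]].
have J : 0 <= j%:R :> R by [].
have J1 : 0 < j%:R + 1 :> R by lra.
rewrite -natr1 normrM [`|_^-1|]gtr0_norm ?invr_gt0 ?ler_pdivrMr ?mulr_gt0 //.
rewrite (_ : 5 / al * M * _ = 5 * (j%:R + 1) * M); last by field; rewrite gt_eqF.
have p1' : `|(j%:R - 1) * mulX phi_coef j| <= (j%:R + 1) * M.
  by rewrite normrM; apply: ler_pM => //; rewrite ler_norml; apply/andP; split; lra.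
have p0' : `|- (2 * j%:R) * phi_coef j| <= 2 * j%:R * M.
  by rewrite mulNr normrN normrM ger0_norm ?mulr_ge0 // ler_wpM2l ?mulr_ge0.
have c2' : `|2 * mulX (mulX chi_coef) j| <= 2 * M.
  by rewrite normrM ger0_norm // ler_wpM2l.
have M0 : 0 <= M by apply: le_trans p0.
have JM : 0 <= j%:R * M by apply: mulr_ge0.
move: p0' p1' c1 c2' c3; rewrite !ler_norml.
move=> /andP[? ?] /andP[? ?] /andP[? ?] /andP[? ?] /andP[? ?].
by apply/andP; split; lra.
Qed.

Lemma chi_coef_step j (M : R) :
  `|chi_coef j| <= M -> `|mulX chi_coef j| <= M ->
  `|phi_coef j.+1| <= 5 / al * M ->
  `|chi_coef j.+1| <= (3 + 2 * al + `|m| * (5 / al)) / al * M.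
Proof.
rewrite chi_coefS => c0 c1 p1.
have J : 0 <= j%:R :> R by [].
have M0 : 0 <= M by apply: le_trans c0.
rewrite normrM [`|_^-1|]gtr0_norm ?invr_gt0 ?ler_pdivrMr ?mulr_gt0 //; try lra.
set Q := `|m| * _.
have Q0 : 0 <= Q by rewrite mulr_ge0 // divr_ge0 // ltW.
rewrite (_ : _ / al * M * _ = (3 + 2 * al + Q) * M * (j%:R + 4)); last first.
  by field; rewrite gt_eqF.
have c0' : `|- (2 * j%:R + 4 - 2 * al) * chi_coef j|
    <= (2 * j%:R + 4 + 2 * al) * M.
  rewrite normrM; apply: ler_pM => //.
  by rewrite ler_norml; have := al0; move=> ?; apply/andP; split; lra.
have c1' : `|(j%:R + 2) * mulX chi_coef j| <= (j%:R + 2) * M.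
  by rewrite normrM ger0_norm ?addr_ge0 // ler_wpM2l ?addr_ge0.
have p1' : `|m * phi_coef j.+1| <= Q * M.
  by rewrite normrM /Q -mulrA ler_wpM2l.
have JM : 0 <= j%:R * M by apply: mulr_ge0.
have QM : 0 <= Q * M by apply: mulr_ge0.
have aM : 0 <= al * M by apply: mulr_ge0 => //; exact: ltW.
have JQM : 0 <= j%:R * (Q * M) by apply: mulr_ge0.
have JaM : 0 <= j%:R * (al * M) by apply: mulr_ge0.
apply: (le_trans (ler_normD _ _)).
apply: (le_trans (lerD (ler_normD _ _) p1')).
apply: (@le_trans _ _ ((2 * j%:R + 4 + 2 * al) * M + (j%:R + 2) * M + Q * M)).
  by rewrite lerD2r lerD.
nra.
Qed.

Lemma coefs_geometric j : let M := (1 + `|m / (3 * al)|) * coef_growth ^+ j in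
  [/\ `|phi_coef j| <= M, `|mulX phi_coef j| <= M, `|chi_coef j| <= M,
      `|mulX chi_coef j| <= M &
      `|mulX (mulX chi_coef) j| <= M /\ `|mulX (mulX (mulX chi_coef)) j| <= M].
Proof.
elim: j => [|j [p0 p1 c0 c1 [c2 c3]]] /=.
  have N : 0 <= `|m / (3 * al)| by [].
  by rewrite expr0 mulr1 /phi_coef /chi_coef /= !normr0 normr1; do !split; lra.
set M := _ * coef_growth ^+ j in p0 p1 c0 c1 c2 c3 *.
rewrite exprS mulrCA -/M.
have M0 : 0 <= M by apply: le_trans p0.
have al5 : 0 <= 5 / al by rewrite divr_ge0 // ltW.
have pS : `|phi_coef j.+1| <= 5 / al * M.
  by apply: phi_coef_step; rewrite /= p0 p1 c1 c2 c3.
have cS := chi_coef_step c0 c1 pS.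
have W u : `|u| <= M -> `|u| <= coef_growth * M.
  by move=> /le_trans; apply; rewrite ler_peMl // coef_growth_ge1.
have al5' : 0 <= (3 + 2 * al + `|m| * (5 / al)) / al.
  by rewrite divr_ge0 ?(ltW al0) // !addr_ge0 ?mulr_ge0 ?invr_ge0 ?(ltW al0).
split; [apply: (le_trans pS)|exact: W|apply: (le_trans cS)|exact: W|].
- by apply: ler_wpM2r => //; rewrite /coef_growth; lra.
- by apply: ler_wpM2r => //; rewrite /coef_growth; lra.
- by split; exact: W.
Qed.

Lemma phi_coef_eq j :
  al * pseries_diffs phi_coef j + 2 * mulX (pseries_diffs phi_coef) j
    + (-1) * mulX (mulX (pseries_diffs phi_coef)) j
  = mulX chi_coef j + (-2) * mulX (mulX chi_coef) j
    + mulX (mulX (mulX chi_coef)) j.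
Proof.
have E : mulX (pseries_diffs phi_coef) j = j%:R * phi_coef j.
  by case: j => [|j]; rewrite ?mul0r.
have E2 : mulX (mulX (pseries_diffs phi_coef)) j = (j%:R - 1) * mulX phi_coef j.
  case: j {E} => [|[|j]] /=; rewrite ?mulr0 ?subrr ?mul0r //.
  by rewrite -[in RHS]natr1 addrK.
rewrite E E2 /pseries_diffs phi_coefS.
have J : j%:R + 1 != 0 :> R by rewrite natr1 pnatr_eq0.
by rewrite -natr1; field; rewrite J gt_eqF.
Qed.

Lemma chi_coef_eq j :
  al * mulX (pseries_diffs chi_coef) j
    + 2 * mulX (mulX (pseries_diffs chi_coef)) j
    + (-1) * mulX (mulX (mulX (pseries_diffs chi_coef))) j
  = (- (3 * al)) * chi_coef j + (- (4 - 2 * al)) * mulX chi_coef j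
    + 3 * mulX (mulX chi_coef) j + m * phi_coef j.
Proof.
case: j => [|j] /=.
  by rewrite /chi_coef /phi_coef /=; field; rewrite gt_eqF.
have E : mulX (pseries_diffs chi_coef) j = j%:R * chi_coef j.
  by case: j => [|j]; rewrite ?mul0r.
have E2 : mulX (mulX (pseries_diffs chi_coef)) j = (j%:R - 1) * mulX chi_coef j.
  case: j {E} => [|[|j]] /=; rewrite ?mulr0 ?subrr ?mul0r //.
  by rewrite -[in RHS]natr1 addrK.
rewrite E E2 /pseries_diffs chi_coefS -natr1.
have J : 0 < j%:R + 4 :> R by rewrite ltr_wpDl.
by field; rewrite !gt_eqF.
Qed.

(** The formal solution converges by the geometric bound, and the two
    equations hold because both sides have the same coefficients. *)
Lemma linear_system_solution : exists rho (phi chi dphi dchi : R -> R),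
  [/\ 0 < rho, psum rho phi_coef phi, psum rho chi_coef chi &
   forall x : R, `|x| < rho ->
   [/\ is_derive x 1 phi (dphi x), is_derive x 1 chi (dchi x),
      (al + 2 * x - x ^+ 2) * dphi x = x * (1 - x) ^+ 2 * chi x &
      (al + 2 * x - x ^+ 2) * (x * dchi x) =
        - (3 * al + (4 - 2 * al) * x - 3 * x ^+ 2) * chi x + m * phi x]].
Proof.
have g0 : 0 < coef_growth by apply: lt_le_trans coef_growth_ge1.
pose M := 1 + `|m / (3 * al)|.
have Sp : psum coef_growth^-1 phi_coef (fun x => limn (pseries phi_coef x)).
  by apply: (@geometric_psum _ _ M) => // j; have [] := coefs_geometric j.
have Sc : psum coef_growth^-1 chi_coef (fun x => limn (pseries chi_coef x)).
  by apply: (@geometric_psum _ _ M) => // j; have [] := coefs_geometric j.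
have [dp Sdp Dp] := psum_diffs Sp; have [dc Sdc Dc] := psum_diffs Sc.
set phi := (fun x => limn _) in Sp Dp; set chi := (fun x => limn _) in Sc Dc.
exists coef_growth^-1, phi, chi, dp, dc; split=> //; first by rewrite invr_gt0.
clearbody phi chi.
move=> x xr; split; [exact: Dp|exact: Dc| |].
  have L := psumD (psumD (@psumZ _ _ al _ _ Sdp) (@psumZ _ _ 2 _ _ (psumX Sdp)))
    (@psumZ _ _ (-1) _ _ (psumX (psumX Sdp))).
  have K := psumD (psumD (psumX Sc) (@psumZ _ _ (-2) _ _ (psumX (psumX Sc))))
    (psumX (psumX (psumX Sc))).
  rewrite (funext phi_coef_eq) in L.
  by have /= E := psum_unique L K xr; apply: (etrans _ (etrans E _)); ring.
have L := psumD (psumD (@psumZ _ _ al _ _ (psumX Sdc))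
  (@psumZ _ _ 2 _ _ (psumX (psumX Sdc))))
  (@psumZ _ _ (-1) _ _ (psumX (psumX (psumX Sdc)))).
have K := psumD (psumD (psumD (@psumZ _ _ (- (3 * al)) _ _ Sc)
  (@psumZ _ _ (- (4 - 2 * al)) _ _ (psumX Sc)))
  (@psumZ _ _ 3 _ _ (psumX (psumX Sc)))) (@psumZ _ _ m _ _ Sp).
rewrite (funext chi_coef_eq) in L.
by have /= E := psum_unique L K xr; apply: (etrans _ (etrans E _)); ring.
Qed.

End linear_system.

(** * The self-similar profile of the correction *)

Section profile.
Variable R : realType.
Implicit Types (f g : R -> R) (rho al m : R).

Lemma open_norm_lt rho : open [set x : R | `|x| < rho].
Proof.
apply: (@open_comp _ _ (fun x : R => `|x|) [set x | x < rho]) => [x _|].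
  exact: norm_continuous.
exact: open_lt.
Qed.

Lemma antiderivative rho g : 0 < rho ->
  (forall x : R, `|x| < rho -> {for x, continuous g}) ->
  exists2 f, f 0 = 0 & forall x : R, `|x| < rho / 2 -> is_derive x 1 f (g x).
Proof.
move=> rho0 cg; pose u := rho * (3 / 4).
pose F x := \int[lebesgue_measure]_(t in `[- u, x]) g t.
have ig : lebesgue_measure.-integrable `[- u, u] (EFin \o g).
  apply: continuous_compact_integrable; first exact: segment_compact.
  apply: continuous_in_subspaceT => x; rewrite inE /= in_itv /= -ler_norml => xu.
  by apply: cg; apply: (le_lt_trans xu); rewrite /u; lra.
exists (fun x => F x - F 0) => [|x xr]; first exact: subrr.
have [ux xu] : - u < x /\ x < u by apply/andP; rewrite -ltr_norml /u; lra.
have [|dF FE] := continuous_FTC1_closed xu ig ux.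
  by apply: cg; lra.
rewrite -[g x]subr0; apply: is_deriveB.
by apply: DeriveDef => //; rewrite -derive1E.
Qed.

Lemma psum_at0 rho (c : R^nat) F : 0 < rho -> psum rho c F -> F 0 = c 0.
Proof.
move=> rho0 /(_ 0); rewrite normr0 => /(_ rho0) cF.
suff c0 : pseries c 0 @ \oo --> c 0 by exact: cvg_unique cF c0.
rewrite -(cvg_shiftS (pseries _ _)).
have -> : [sequence pseries c 0 n.+1]_n = (fun=> c 0); last exact: cvg_cst.
apply/funext => n; rewrite /pseries /series /= big_nat_recl //= expr0 mulr1.
by rewrite big1 ?addr0 // => i _; rewrite exprS mul0r mulr0.
Qed.

(** With [g = - x chi / phi], the term in [g^2] cancels against the one from
    the derivative of [1 / phi] by the first equation of the linear system,
    and the second equation is what remains. When [m = 0], the zero profile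
    is chosen, which makes the correction vanish identically in dimension
    [3]. *)
Lemma correction_profile al m : 0 < al -> exists rho f g dg,
  [/\ 0 < rho,
      forall k, Cn k [set x : R | `|x| < rho] f,
      forall x : R, `|x| < rho ->
        [/\ is_derive x 1 f (g x), is_derive x 1 g (dg x) &
            x * (al + 2 * x - x ^+ 2) * dg x + 2 * (1 - x) * (x + al) * g x
            - x * (1 - x) ^+ 2 * g x ^+ 2 + m * x = 0],
      f 0 = 0 /\ g 0 = 0 &
      m = 0 -> forall x, f x = 0].
Proof.
move=> al0; have [->|m0] := eqVneq m 0.
  exists 1, (fun=> 0), (fun=> 0), (fun=> 0); split=> // [k|x _].
    by apply: Cn_cst; exact: open_norm_lt.
  by split; [exact: is_derive_cst|exact: is_derive_cst|ring].
have [rho1 [phi [chi [dphi [dchi [rho10 Sp Sc sys]]]]]] :=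
  linear_system_solution m al0.
have phi0 : phi 0 = 1 by rewrite (psum_at0 rho10 Sp).
have cphi : {for 0, continuous phi}.
  have [] := sys 0; rewrite ?normr0 // => -[dphi0 _] _ _ _.
  exact/differentiable_continuous/derivable1_diffP.
have : \forall x \near (0 : R), 0 < phi x.
  have cphi' : phi x @[x --> 0] --> phi 0 by [].
  by apply: (cvgr_gt _ cphi'); rewrite phi0.
move=> /nbhs_ballP[rho2 /= rho20 phi_gt0].
(* for |x| < 1 and |x| < al / 4, |2 x - x^2| <= 3 |x| < al *)
pose rho := Num.min (Num.min rho1 rho2) (Num.min 1 (al / 4)).
have rho0 : 0 < rho by rewrite !lt_min rho10 rho20 ltr01 divr_gt0.
have small (x : R) : `|x| < rho ->
    [/\ `|x| < rho1, 0 < phi x & 0 < al + 2 * x - x ^+ 2].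
  rewrite !lt_min => /andP[/andP[x1 x2] /andP[x3 x4]]; split=> //.
    by apply: phi_gt0; rewrite /ball /= sub0r normrN.
  have := ler_norm (- x); have : x ^+ 2 <= `|x|.
    by rewrite -real_normK ?num_real // expr2 ler_piMl // ltW.
  by rewrite normrN; lra.
pose U := [set x : R | `|x| < rho].
have oU : open U by exact: open_norm_lt.
pose g x := - (x * chi x / phi x).
have Cg k : Cn k U g.
  have subU : U `<=` [set x : R | `|x| < rho1] by move=> x /small[].
  apply: (CnN oU); apply: (CnM oU).
    apply: (CnM oU); first exact: Cn_id.
    exact: Cn_sub subU (psum_smooth k Sc).
  apply: (Cn_comp1 oU) (@Cn_inv R k) (Cn_sub subU (psum_smooth k Sp)).
  by move=> x /small[_ /lt0r_neq0].
have [f f0 Df] : exists2 f, f 0 = 0 &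
    forall x : R, `|x| < rho / 2 -> is_derive x 1 f (g x).
  by apply: antiderivative => // x; exact: Cn_continuous (Cg 0).
have sub2 : [set x : R | `|x| < rho / 2] `<=` U by move=> x; rewrite /U /=; lra.
exists (rho / 2), f, g, (fun x => - ((x * dchi x + chi x) / phi x
                         - x * chi x * dphi x / phi x ^+ 2)).
split=> [||x xr||/eqP]; last by rewrite (negbTE m0).
- by rewrite divr_gt0.
- case=> [|k]; last first.
    exact: (Cn_real (@open_norm_lt _) Df (Cn_sub sub2 (Cg k))).
  by apply: CnW; exact: (Cn_real (@open_norm_lt _) Df (Cn_sub sub2 (Cg 0))).
- have [xr1 phix P0] := small x (sub2 x xr).
  have [Dphi Dchi E1 E2] := sys x xr1.
  have p0 : phi x != 0 by rewrite gt_eqF.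
  split; first exact: Df.
    have Dinv : is_derive x 1 (fun y => (phi y)^-1) (- phi x ^- 2 *: dphi x).
      exact: is_deriveV.
    rewrite /g; apply: is_derive_eq; rewrite /= /GRing.scale /=.
    by field.
  have -> : dphi x = x * (1 - x) ^+ 2 * chi x / (al + 2 * x - x ^+ 2).
    by rewrite -E1; field; rewrite gt_eqF.
  have Edc : x * dchi x = (- (3 * al + (4 - 2 * al) * x - 3 * x ^+ 2) * chi x
      + m * phi x) / (al + 2 * x - x ^+ 2).
    by rewrite -E2; field; rewrite gt_eqF.
  by rewrite Edc /g; field; rewrite p0 gt_eqF.
- by split=> //; rewrite /g mul0r mul0r oppr0.
Qed.

End profile.

(** * Radial derivatives of self-similar functions *)

Section self_similar_derivatives.
Variable R : realType.
Implicit Types (f g h : R -> R) (rho d C x s r q : R) (c j : nat).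

(** Since [d sigma / dr = (1 - sigma) / r], the radial derivative of
    [r^-c h (sigma)] is [r^-(c+1)] times [(- c h + (1 - x) h') (sigma)]; this
    iterates that operation on the profile [h]. *)
Fixpoint profile_dr (c j : nat) (h : R -> R) : R -> R :=
  if j is i.+1 then
    fun x => - ((c + i)%:R * profile_dr c i h x)
             + (1 - x) * 'D_1 (profile_dr c i h) x
  else h.

(** The self-similar variable [sigma = (s + (r - q)) / r] at a fixed time; it
    satisfies [d sigma / dr = (1 - sigma) / r]. *)
Definition flow_ratio (s q r : R) : R := (s + (r - q)) / r.

Lemma smooth_profile_dr (U : set R) c j h : open U ->
  (forall k, Cn k U h) -> forall k, Cn k U (profile_dr c j h).
Proof.
move=> oU; elim: j => // j IH Ch k /=; have [_ CD] := IH Ch k.+1.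
apply: (CnD oU).
  by apply: (CnN oU); apply: (CnM oU); [exact: Cn_cst|exact: IH].
apply: (CnM oU) (CD 1); apply: (CnD oU); first exact: Cn_cst.
by apply: (CnN oU); exact: Cn_id.
Qed.

Lemma is_derive_flow_ratio s q r : 0 < r ->
  is_derive r 1 (flow_ratio s q) ((1 - flow_ratio s q r) / r).
Proof.
move=> r_gt0; have q' : r != 0 by rewrite gt_eqF.
have Dinv : is_derive r 1 (@GRing.inv R) (- r ^- 2 *: 1).
  exact: (@is_deriveV _ idfun).
rewrite /flow_ratio; apply: is_derive_eq.
by rewrite /GRing.scale /=; field.
Qed.

(** The condition [|sigma| < rho], multiplied by [r] so that openness is
    immediate. *)
Definition flow_dom s q rho := [set r : R | 0 < r /\ `|s + (r - q)| < rho * r].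

Lemma open_flow_dom s q rho : open (flow_dom s q rho).
Proof.
rewrite (_ : flow_dom _ _ _ = [set r : R | 0 < r] `&`
   (fun r => rho * r - `|s + (r - q)|) @^-1` [set y | 0 < y]); last first.
  by apply/seteqP; split=> r [r1 r2]; split=> //; move: r2; rewrite /= subr_gt0.
apply: openI; first exact: open_gt.
apply: open_comp; last exact: open_gt.
move=> r _; apply: cvgB; first by apply: cvgM; [exact: cvg_cst|exact: cvg_id].
apply: cvg_norm; apply: cvgD; first exact: cvg_cst.
by apply: cvgB; [exact: cvg_id|exact: cvg_cst].
Qed.

Lemma flow_ratio_dom s q rho r : flow_dom s q rho r ->
  `|flow_ratio s q r| < rho.
Proof.
by move=> [r_gt0 sr]; rewrite normrM normfV (gtr0_norm r_gt0) ltr_pdivrMr.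
Qed.

Lemma derive1n_profile rho h c s q j r (F : R -> R) :
  (forall k, Cn k [set x : R | `|x| < rho] h) ->
  (forall r', flow_dom s q rho r' ->
    F r' = (r' ^+ c)^-1 * h (flow_ratio s q r')) ->
  flow_dom s q rho r ->
  derive1n j F r = (r ^+ (c + j))^-1 * profile_dr c j h (flow_ratio s q r).
Proof.
move=> Ch FE; elim: j r => [|j IH] r rD; first by rewrite derive1n0 addn0 FE.
rewrite derive1nS derive1E.
pose G r' := (r' ^+ (c + j))^-1 * profile_dr c j h (flow_ratio s q r').
rewrite (near_eq_derive 1 (g := G)); last first.
  near=> r'; apply: IH; near: r'.
  by apply: open_nbhs_nbhs; split=> //; exact: open_flow_dom.
have r_gt0 : 0 < r by case: rD.
have rn0 : r != 0 by rewrite gt_eqF.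
have Dh : is_derive r 1 (fun r' => profile_dr c j h (flow_ratio s q r'))
    ('D_1 (profile_dr c j h) (flow_ratio s q r) * ((1 - flow_ratio s q r) / r)).
  apply: is_derive_comp1; last exact: is_derive_flow_ratio.
  have CH := smooth_profile_dr c j (@open_norm_lt R rho) Ch 0.
  exact: Cn_is_derive_at CH (flow_ratio_dom rD).
have DX : is_derive r 1 (fun r' : R => r' ^+ (c + j))
    ((c + j)%:R * r ^+ (c + j).-1).
  apply: DeriveDef; first exact: exprn_derivable.
  by rewrite exp_derive /GRing.scale /= mulr1.
have DV : is_derive r 1 (fun r' : R => (r' ^+ (c + j))^-1)
    (- (r ^+ (c + j)) ^- 2 *: ((c + j)%:R * r ^+ (c + j).-1)).
  by apply: is_deriveV => //; rewrite expf_neq0.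
have [_ ->] : is_derive r 1 G _ := is_deriveM DV Dh.
rewrite /GRing.scale /= addnS exprS.
case: (c + j)%N => [|i] /=; last rewrite !exprS expr0.
  by rewrite !mul0r expr0 mulr0 mulr0 addr0 oppr0 add0r; field.
by field; rewrite rn0 expf_neq0.
Unshelve. all: by end_near. Qed.

Lemma locally_bounded (U : set R) h : open U -> U 0 -> {for 0, continuous h} ->
  exists d C, [/\ 0 < d, 0 < C & forall x, `|x| < d -> `|h x| <= C].
Proof.
move=> oU U0 ch.
have : \forall x \near (0 : R), `|h x| < `|h 0| + 1.
  have cn : `|h x| @[x --> 0] --> `|h 0| by apply: cvg_norm.
  by apply: (cvgr_lt _ cn); rewrite ltrDl.
move=> /nbhs_ballP[d /= d0 dh]; exists d, (`|h 0| + 1); split=> // x xd.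
by apply/ltW/dh; rewrite /ball /= sub0r normrN.
Qed.

(** The mean value theorem gains one order of vanishing. *)
Lemma vanishing_order d C p f g : 0 <= C -> f 0 = 0 ->
  (forall x, `|x| < d -> is_derive x 1 f (g x) /\ `|g x| <= C * `|x| ^+ p) ->
  forall x, `|x| < d -> `|f x| <= C * `|x| ^+ p.+1.
Proof.
move=> C0 f0 fg x xd.
have cf a b : `|a| < d -> `|b| < d -> {within `[a, b], continuous f}.
  move=> ad bd; apply: continuous_in_subspaceT => y.
  rewrite inE /= in_itv /= => /andP[ay yb].
  have [|[dfy _] _] := fg y.
    move: ad bd; rewrite !ltr_norml => /andP[? ?] /andP[? ?].
    by apply/andP; split; lra.
  exact/differentiable_continuous/derivable1_diffP.
have M y : `|y| <= `|x| -> `|g y * x| <= C * `|x| ^+ p.+1.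
  move=> yx; have [_ gy] := fg y (le_lt_trans yx xd).
  rewrite normrM exprSr mulrA ler_wpM2r //; apply: (le_trans gy).
  by rewrite ler_wpM2l // lerXn2r ?nnegrE.
have d0 : `|0 : R| < d by rewrite normr0 (le_lt_trans _ xd).
have D a b : `|a| < d -> `|b| < d ->
    forall y : R, y \in `]a, b[%R -> is_derive y 1 f (g y).
  move=> ad bd y; rewrite in_itv /= => /andP[ay yb].
  have [|//] := fg y.
  move: ad bd; rewrite !ltr_norml => /andP[? ?] /andP[? ?].
  by apply/andP; split; lra.
have [x0|x0|->] := ltgtP x 0.
- have [y yI fE] := MVT x0 (D _ _ xd d0) (cf _ _ xd d0).
  rewrite (_ : f x = g y * x); last by move: fE; rewrite f0; lra.
  apply: M; move: yI; rewrite in_itv /= => /andP[xy y0].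
  by rewrite !ler0_norm ?(ltW x0) ?(ltW y0) //; lra.
- have [y yI fE] := MVT x0 (D _ _ d0 xd) (cf _ _ d0 xd).
  rewrite (_ : f x = g y * x); last by move: fE; rewrite f0; lra.
  apply: M; move: yI; rewrite in_itv /= => /andP[y0 yx].
  by rewrite !ger0_norm ?(ltW x0) ?(ltW y0) //; lra.
- by rewrite f0 normr0 mulr_ge0 // exprn_ge0.
Qed.

End self_similar_derivatives.

(** * Orders of vanishing and a bound for the L2 norm *)

Section profile_bounds.
Variable R : realType.
Implicit Types (f g h : R -> R) (rho d C x : R) (c j N : nat).

Definition bounded_order (p : nat) h (d C : R) :=
  forall x, `|x| < d -> `|h x| <= C * `|x| ^+ p.

Lemma bounded_orderW p h d C d' C' : d' <= d -> C <= C' ->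
  bounded_order p h d C -> bounded_order p h d' C'.
Proof.
move=> dd' CC' hb x xd'; apply: (le_trans (hb x (lt_le_trans xd' dd'))).
by rewrite ler_wpM2r // exprn_ge0.
Qed.

Lemma common_order (p : nat -> nat) (h : nat -> R -> R) :
  (forall j, exists d C, [/\ 0 < d, 0 < C & bounded_order (p j) (h j) d C]) ->
  forall N, exists d C, [/\ 0 < d, 0 < C &
    forall j, (j <= N)%N -> bounded_order (p j) (h j) d C].
Proof.
move=> hb; elim=> [|N [d [C [d0 C0 IH]]]].
  have [d [C [d0 C0 H]]] := hb 0%N.
  by exists d, C; split=> // j; rewrite leqn0 => /eqP ->.
have [d' [C' [d'0 C'0 H]]] := hb N.+1.
exists (Num.min d d'), (C + C'); split; rewrite ?lt_min ?d0 ?addr_gt0 //.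
move=> j; rewrite leq_eqVlt => /orP[/eqP ->|].
  by apply: bounded_orderW H; rewrite ?ge_min ?lexx ?orbT // lerDr ltW.
rewrite ltnS => /IH; apply: bounded_orderW; first by rewrite ge_min lexx.
by rewrite lerDl ltW.
Qed.

(** Vanishing is claimed only while [c + j < 2], and comes from
    [f 0 = g 0 = 0]; otherwise [2 - (c + j)] is [0] and continuity
    suffices. With [c = 0] the statement is about the radial derivatives of
    [f (sigma)], with [c = 1] about those of [r^-1 g (sigma)], the shape of
    its time derivative. *)
Lemma profile_dr_order rho f g c j : 0 < rho ->
  (forall k, Cn k [set x : R | `|x| < rho] f) ->
  (forall x : R, `|x| < rho -> is_derive x 1 f (g x)) ->
  f 0 = 0 -> g 0 = 0 -> (c <= 1)%N ->
  exists d C, [/\ 0 < d, 0 < C &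
    bounded_order (2 - (c + j)) (profile_dr c j (if c == 0 then f else g)) d C].
Proof.
move=> rho0 Cf Df f0 g0 c1; pose U := [set x : R | `|x| < rho].
have oU : open U by exact: open_norm_lt.
have U0 : U 0 by rewrite /U /= normr0.
have Cg k : Cn k U g.
  have [_ CD] := Cf k.+1; apply: (Cn_eq oU) (CD 1) => x /set_mem Ux.
  by have [_ ->] := Df x Ux.
have Dg (x : R) : U x -> is_derive x 1 g ('D_1 g x).
  by move=> Ux; exact: Cn_is_derive_at (Cg 0) Ux.
have [d [C [d0 C0 Dgb]]] : exists d C, [/\ 0 < d, 0 < C &
    forall x, `|x| < d -> `|'D_1 g x| <= C].
  apply: (@locally_bounded _ U) => //; have [_ CD] := Cg 1.
  have Cd : Cn 0 U ('D_1 g) := CD 1.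
  exact: Cn_continuous Cd U0.
pose d1 := Num.min (Num.min rho 1) d.
have d10 : 0 < d1 by rewrite !lt_min rho0 ltr01.
have d1P x : `|x| < d1 -> [/\ U x, `|x| < 1 & `|x| < d].
  by rewrite !lt_min => /andP[/andP[? ?] ?].
have gb : bounded_order 1 g d1 C.
  apply: (@vanishing_order _ d1 C 0 g ('D_1 g)) => //; first exact: ltW.
  move=> x /d1P[Ux _ xd]; split; first exact: Dg.
  by rewrite expr0 mulr1; exact: Dgb.
have fb : bounded_order 2 f d1 C.
  apply: (@vanishing_order _ d1 C 1 f g) => //; first exact: ltW.
  by move=> x xd1; split; [by apply: Df; have [] := d1P x xd1|exact: gb].
have [cj|cj] := leqP 2 (c + j).
  have -> : (2 - (c + j) = 0)%N by apply/eqP.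
  set h := if _ then _ else _; have Ch k : Cn k U h by rewrite /h; case: ifP.
  have CH := smooth_profile_dr c j oU Ch 0.
  have [d' [C' [d'0 C'0 H]]] := locally_bounded oU U0 (Cn_continuous CH U0).
  by exists d', C'; split=> // x xd'; rewrite expr0 mulr1; exact: H.
case: c c1 j cj => [|[|c]] // _ [|[|j]] // _ /=.
- by exists d1, C.
- exists d1, (2 * C); split=> // [|x xd1]; first by rewrite mulr_gt0.
  have [Ux x1 _] := d1P x xd1.
  have [_ ->] := Df x Ux; rewrite addn0 mul0r oppr0 add0r normrM -mulrA.
  apply: ler_pM => //; last exact: gb.
  by move: x1; rewrite ltr_norml ler_norml => /andP[? ?]; apply/andP; split; lra.
- by exists d1, C.
Qed.

End profile_bounds.

Section L2_bound.
Variable R : realType.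
Local Open Scope ereal_scope.

(** The integral of a nonnegative function is a supremum over the simple
    functions below it, hence monotone even for functions that are not
    measurable; a pointwise bound then controls the L2 norm by itself. *)
Lemma ge0_le_integral_monotone d (T : measurableType d)
    (mu : {measure set T -> \bar R}) (F G : T -> \bar R) :
  (forall x, 0 <= F x) -> (forall x, F x <= G x) ->
  \int[mu]_x F x <= \int[mu]_x G x.
Proof.
move=> F0 FG; rewrite !ge0_integralTE //; last first.
  by move=> x; exact: le_trans (F0 x) (FG x).
apply: ereal_sup_le => _ [h hF <-]; exists h => // x.
exact: le_trans (hF x) (FG x).
Qed.

Lemma L2norm_rball_le (F : R -> R) (r0 rad M : R) : (0 < rad)%R -> (0 <= M)%R ->
  (forall r, rball r0 rad r -> `|F r| <= M)%R ->
  L2norm (rball r0 rad) F <= (M * (2 * rad) `^ (1 / 2))%:E.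
Proof.
move=> rad0 M0 FM; rewrite /L2norm unlock /Lnorm.
have mB : measurable (rball r0 rad) by exact: measurable_itv.
have mE : lebesgue_measure (rball r0 rad) = (2 * rad)%:E.
  rewrite /rball lebesgue_measure_itv /= lte_fin ifT; last by lra.
  by rewrite -EFinD; congr _%:E; ring.
have I : \int[lebesgue_measure]_x `|(F x * \1_(rball r0 rad) x)%:E| `^ 2
    <= (M ^+ 2 * (2 * rad))%:E.
  apply: (@le_trans _ _ (\int[lebesgue_measure]_(x in rball r0 rad) (M ^+ 2)%:E)).
    rewrite [leRHS]integral_mkcond.
    apply: ge0_le_integral_monotone => x; first exact: poweR_ge0.
    rewrite /patch abse_EFin poweR_EFin; case: ifPn => xB; last first.
      by rewrite indicE (negbTE xB) mulr0 normr0 powR0.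
    rewrite indicE xB mulr1 lee_fin powR_mulrn // lerXn2r ?nnegrE //.
    exact/FM/set_mem.
  apply: (@le_trans _ _ ((M ^+ 2)%:E * lebesgue_measure (rball r0 rad))).
    by rewrite integral_cst.
  by rewrite mE.
apply: (@le_trans _ _ ((M ^+ 2 * (2 * rad))%:E `^ 2^-1)).
  apply: gt0_ler_poweR; rewrite ?in_itv /= ?leey ?andbT ?invr_ge0 //.
    by apply: integral_ge0 => x _; rewrite lee_fin powR_ge0.
  by rewrite lee_fin mulr_ge0 ?exprn_ge0 // mulr_ge0 // ltW.
have r2 : (0 <= 2 * rad)%R by rewrite mulr_ge0 // ltW.
rewrite poweR_EFin lee_fin powRM ?exprn_ge0 // -powR_mulrn // -powRrM.
by rewrite divff // powRr1 // div1r.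
Qed.

End L2_bound.

(** * Radius, time and coordinates on space-time *)

Section affine_functions.
Variables (R : realType) (V : normedModType R).
Implicit Types (f : V -> R) (x v : V) (U : set V).

(** The coordinates of space-time are affine along every line. *)
Lemma is_derive_affine f x v (d : R) :
  (forall k : R, f (k *: v + x) = k * d + f x) -> is_derive x v f d.
Proof.
move=> fE; apply/is_derive_line; rewrite (funext fE).
rewrite (_ : (fun k : R => _) = (id * cst d + cst (f x))) //.
by apply: is_derive_eq; rewrite /= scaler0 add0r addr0 [_ *: _]mulr1.
Qed.

Lemma Cn_affine m U f (d : V -> R) : open U -> continuous f ->
  (forall x v (k : R), f (k *: v + x) = k * d v + f x) -> Cn m U f.
Proof.
move=> oU cf fE; apply: CnW; apply: Cn_is_derive => // [x _|v]; first exact: cf.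
exists (fun=> d v); last exact: Cn_cst.
by move=> x _; apply: is_derive_affine => k; exact: fE.
Qed.

Lemma Cn_sum m U (I : Type) (s : seq I) (F : I -> V -> R) : open U ->
  (forall i, Cn m U (F i)) -> Cn m U (fun x => \sum_(i <- s) F i x).
Proof.
move=> oU CF; elim: s => [|i s IH].
  by apply: (Cn_eq oU) (Cn_cst m 0 oU) => x _; rewrite big_nil.
by apply: (Cn_eq oU) (CnD oU (CF i) IH) => x _; rewrite big_cons.
Qed.

End affine_functions.

Section space_time_coordinates.
Variables (R : realType) (n : nat).
Local Notation V := ('rV[R]_n * R)%type.
Implicit Types (p w : V) (U : set V).

Definition radius p := enorm p.1.
Definition time p : R := p.2.
Definition coord i p : R := p.1 ord0 i.

Lemma continuous_time : continuous time.
Proof. by move=> p; exact: cvg_snd. Qed.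

Lemma continuous_coord i : continuous (coord i).
Proof.
move=> p; apply: (@continuous_comp _ _ _ fst (fun x : 'rV[R]_n => x ord0 i)).
  exact: cvg_fst.
exact: coord_continuous.
Qed.

Lemma Cn_time m U : open U -> Cn m U time.
Proof.
move=> oU; apply: (@Cn_affine _ _ m U time snd) => //.
exact: continuous_time.
Qed.

Lemma Cn_coord m U i : open U -> Cn m U (coord i).
Proof.
move=> oU; apply: (@Cn_affine _ _ m U (coord i) (coord i)) => //.
  exact: continuous_coord.
by move=> x v k; rewrite /coord /= !mxE.
Qed.

Lemma Cn_radius m U : open U -> (forall p, U p -> 0 < radius p) -> Cn m U radius.
Proof.
move=> oU U0; apply: (Cn_comp1 oU) (@Cn_sqrt R m) _.
  by move=> p /U0; rewrite /radius /enorm sqrtr_gt0.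
by apply: (Cn_sum _ oU) => i; apply: (CnM oU); exact: Cn_coord.
Qed.

Lemma continuous_radius : continuous radius.
Proof.
move=> p; apply: (@continuous_comp _ _ _
  (fun p : V => \sum_(i < n) p.1 ord0 i ^+ 2)).
  have : Cn 0 setT (fun p : V => \sum_(i < n) p.1 ord0 i ^+ 2).
    apply: Cn_sum => [|i]; first exact: openT.
    have oT : open [set: V] by exact: openT.
    by apply: (CnM oT); exact: Cn_coord.
  by move=> C; exact: Cn_continuous C _.
exact: sqrt_continuous.
Qed.

Lemma radius_sqr p : radius p ^+ 2 = \sum_(i < n) coord i p ^+ 2.
Proof.
by rewrite /radius /enorm sqr_sqrtr // sumr_ge0 // => i _; exact: sqr_ge0.
Qed.

Definition time_dir : V := (0, 1).
Definition space_dir (i : 'I_n) : V := (delta_mx ord0 i, 0).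

Lemma is_derive_time p w : is_derive p w time w.2.
Proof. exact: is_derive_affine. Qed.

Lemma is_derive_coord p w i : is_derive p w (coord i) (coord i w).
Proof. by apply: is_derive_affine => k; rewrite /coord /= !mxE. Qed.

Lemma is_derive_radius p w : 0 < radius p ->
  is_derive p w radius ((\sum_(i < n) coord i p * coord i w) / radius p).
Proof.
move=> N0.
have Dsq : is_derive p w (fun p => \sum_(i < n) coord i p ^+ 2)
    (\sum_(i < n) 2 * (coord i p * coord i w)).
  rewrite (_ : (fun p => _) = \sum_(i < n) (fun p => coord i p ^+ 2)); last first.
    by apply/funext => q; rewrite fct_sumE.
  apply: is_derive_sum => i; have := is_derive_coord p w i.
  by move=> D; apply: is_derive_eq; rewrite /GRing.scale /=; ring.
have q0 : 0 < \sum_(i < n) coord i p ^+ 2 by rewrite -radius_sqr exprn_gt0.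
have := is_derive_comp1 (is_derive1_sqrt q0) Dsq.
rewrite -mulr_sumr -[Num.sqrt _]/(radius p) => D.
rewrite (_ : _ / radius p =
  (2 * radius p)^-1 * (2 * \sum_(i < n) coord i p * coord i w)) //.
by field; rewrite gt_eqF.
Qed.

Lemma is_derive_radius_space p i : 0 < radius p ->
  is_derive p (space_dir i) radius (coord i p / radius p).
Proof.
move=> N0; have := is_derive_radius (space_dir i) N0.
rewrite (bigD1 i) //= big1 => [|j ji]; rewrite /coord /space_dir /= !mxE ?eqxx.
  by rewrite mulr1 addr0.
by rewrite (negbTE ji) mulr0.
Qed.

Lemma is_derive_radius_time p : 0 < radius p -> is_derive p time_dir radius 0.
Proof.
move=> N0; have := is_derive_radius time_dir N0.
by rewrite big1 ?mul0r // => i _; rewrite /coord /time_dir /= mxE mulr0.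
Qed.

End space_time_coordinates.

Arguments radius {R n} p.
Arguments time {R n} p.
Arguments coord {R n} i p.
Arguments time_dir {R n}.

Section time_slices.
Variables (R : realType) (n : nat).
Local Notation V := ('rV[R]_n * R)%type.
Implicit Types (F : V -> R) (s : seq 'rV[R]_n) (t : R).

(** Differentiating a time slice and differentiating in a spatial direction
    use the same difference quotients, so slices commute with derivatives
    exactly, for every function. *)
Lemma derive_quotient_slice F t (x y : 'rV[R]_n) :
  (fun h : R => h^-1 *: (((fun x => F (x, t)) \o shift x) (h *: y) - F (x, t))) =
  (fun h : R => h^-1 *: ((F \o shift (x, t)) (h *: (y, 0)) - F (x, t))).
Proof.
apply/funext => h /=; congr (_ *: (F _ - _)).
by apply/pair_equal_spec; split=> //=; rewrite scaler0 add0r.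
Qed.

Lemma iter_derive_slice F t s :
  iter_derive s (fun x => F (x, t)) =
  fun x => iter_derive [seq (y, 0) | y <- s] F (x, t).
Proof.
elim: s => //= y s ->; apply/funext => x.
by rewrite /derive derive_quotient_slice.
Qed.

Lemma smooth_on_slice F t (U A : set V) : open U -> A `<=` U ->
  smooth_on_open U F -> smooth_on [set x | A (x, t)] (fun x => F (x, t)).
Proof.
move=> oU AU sF; have cp : continuous (fun x : 'rV[R]_n => (x, t)).
  by move=> x; apply/differentiable_continuous/differentiable_pair.
exists ((fun x => (x, t)) @^-1` U); split.
- by apply: open_comp => // x _; exact: cp.
- by move=> x; exact: AU.
move=> s x Ux; rewrite iter_derive_slice.
have [cF dF] := sF [seq (y, 0) | y <- s] (x, t) Ux.
split=> [|y]; first exact: (continuous_comp (cp x) cF).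
by rewrite /derivable derive_quotient_slice; exact: dF.
Qed.

End time_slices.

(** * The blow-up solution on its domain of smoothness *)

Section blowup_solution.
Variables (R : realType) (n : nat) (al b q T kap rho : R) (f g dg : R -> R).
Local Notation V := ('rV[R]_n * R)%type.
Implicit Types p w : V.

Let m : R := (n%:R - 1) * (n%:R - 3) / 4.

Hypotheses (bE : b ^+ 2 = 1 + al) (bS : Num.sqrt (1 + al) = b).
Hypotheses (q_gt0 : 0 < q) (T_gt0 : 0 < T).
Hypothesis Cf : forall k, Cn k [set x : R | `|x| < rho] f.
Hypothesis fP : forall x : R, `|x| < rho ->
  [/\ is_derive x 1 f (g x), is_derive x 1 g (dg x) &
      x * (al + 2 * x - x ^+ 2) * dg x + 2 * (1 - x) * (x + al) * g x
      - x * (1 - x) ^+ 2 * g x ^+ 2 + m * x = 0].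

(** The quantity [s]: [gap / (T - time)] is the argument of the second
    logarithm, and [s = 0] is the singular line. *)
Definition gap p : R := b * (T - time p) + (radius p - q).
Definition correction (r t : R) : R := f (flow_ratio (b * (T - t)) q r).
Local Notation v := (@blowup_sol R n al kap T q correction).

(** Where the three logarithms are defined and [sigma] lies in the interval
    on which the profile is; negative times are included, so that the initial
    surface lies in the interior. *)
Definition sol_dom : set V :=
  [set p | [/\ 0 < radius p, time p < T, 0 < gap p & `|gap p| < rho * radius p]].

Let sigma p : R := gap p / radius p.

Lemma continuous_gap : continuous gap.
Proof.
move=> p; apply: cvgD.
  apply: cvgM; first exact: cvg_cst.
  by apply: cvgB; [exact: cvg_cst|exact: continuous_time].
by apply: cvgB; [exact: continuous_radius|exact: cvg_cst].
Qed.

Lemma open_sol_dom : open sol_dom.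
Proof.
rewrite (_ : sol_dom = (radius @^-1` [set x | 0 < x] `&` time @^-1` [set x | x < T])
    `&` (gap @^-1` [set x | 0 < x] `&`
      (fun p => rho * radius p - `|gap p|) @^-1` [set x | 0 < x])); last first.
  apply/seteqP; split=> p; rewrite /sol_dom /=; first by case; rewrite subr_gt0.
  by rewrite subr_gt0 => -[[]] ? ? []; split.
apply: openI; apply: openI; apply: open_comp; try exact: open_gt;
  try exact: open_lt.
- by move=> p _; exact: continuous_radius.
- by move=> p _; exact: continuous_time.
- by move=> p _; exact: continuous_gap.
- move=> p _; apply: cvgB.
    by apply: cvgM; [exact: cvg_cst|exact: continuous_radius].
  by apply: cvg_norm; exact: continuous_gap.
Qed.

Lemma sol_domP p : sol_dom p ->
  [/\ 0 < radius p, 0 < T - time p, 0 < gap p & `|sigma p| < rho].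
Proof.
move=> [r0 tT s0 sr]; rewrite subr_gt0; split=> //.
by rewrite normrM normfV (gtr0_norm r0) ltr_pdivrMr.
Qed.

Lemma sol_dom_defined p : sol_dom p ->
  [/\ 0 < 1 - p.2 / T, 0 < Num.sqrt (1 + al) + (enorm p.1 - q) / (T - p.2) &
      0 < enorm p.1 / q].
Proof.
move=> /sol_domP[r0 tT s0 _]; split; last by rewrite divr_gt0.
  by rewrite subr_gt0 ltr_pdivrMr // mul1r -subr_gt0.
rewrite bS (_ : b + _ = gap p / (T - time p)) ?divr_gt0 //.
by rewrite /gap /radius /time; field; rewrite gt_eqF.
Qed.

Lemma Cn_blowup_sol k : Cn k sol_dom v.
Proof.
have oU := open_sol_dom.
have CN j : Cn j sol_dom radius by apply: Cn_radius => // p [].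
have Ct j : Cn j sol_dom time by exact: Cn_time.
have Cc j c : Cn j sol_dom (fun=> c) by exact: Cn_cst.
have CTt j : Cn j sol_dom (fun p => T - time p).
  by apply: CnD => //; exact: CnN.
have CNq j : Cn j sol_dom (fun p => radius p - q) by exact: CnD.
rewrite /blowup_sol; apply: CnD => //; apply: CnD => //; last first.
  rewrite /correction /flow_ratio; apply: (Cn_comp1 oU) (Cf k) _.
    by move=> p /sol_domP[].
  apply: CnM => //; last first.
    by apply: Cn_inv_comp => // p [r0 _ _ _]; rewrite gt_eqF.
  by apply: CnD => //; apply: CnM.
apply: CnD => //; last first.
  apply: CnN => //; apply: CnM => //; apply: Cn_ln_comp => //.
    by move=> p /sol_dom_defined[].
  by apply: CnM.
apply: CnD => //; last first.
  apply: CnN => //; apply: CnM => //; apply: Cn_ln_comp => //.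
    by move=> p /sol_dom_defined[].
  apply: CnD => //; apply: CnM => //; apply: Cn_inv_comp => //.
  by move=> p /sol_domP[_ Tt _ _]; rewrite gt_eqF.
apply: CnM => //; apply: Cn_ln_comp => //.
  by move=> p /sol_dom_defined[].
by apply: CnD => //; apply: CnN => //; apply: CnM.
Qed.

Definition dr_sol p : R :=
  - (al / gap p) - (n%:R - 1) / (2 * radius p)
  + g (sigma p) * (1 - sigma p) / radius p.

Definition dt_sol p : R := al * b / gap p - b * g (sigma p) / radius p.

Lemma is_derive_gap p w (a c : R) :
  is_derive p w radius a -> is_derive p w time c ->
  is_derive p w gap (a - b * c).
Proof.
move=> Da Dc; rewrite /gap.
apply: is_derive_eq; rewrite /GRing.scale /=; ring.
Qed.

Lemma is_derive_sigma p w (a c : R) : 0 < radius p ->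
  is_derive p w radius a -> is_derive p w time c ->
  is_derive p w sigma ((1 - sigma p) / radius p * a - b / radius p * c).
Proof.
move=> r0 Da Dc; have Ds := is_derive_gap Da Dc.
have rn0 : radius p != 0 by rewrite gt_eqF.
have Dinv := is_derive_inv_comp rn0 Da.
have [Dp DE] := is_deriveM Ds Dinv; apply: DeriveDef; first exact: Dp.
by rewrite DE /sigma /GRing.scale /=; field.
Qed.

(** Stated for a direction along which radius and time have derivatives [a]
    and [c], so as to give the spatial and the time derivatives at once. *)
Lemma is_derive_sol p w (a c : R) : sol_dom p ->
  is_derive p w radius a -> is_derive p w time c ->
  is_derive p w v (dr_sol p * a + dt_sol p * c).
Proof.
move=> Up Da Dc; have [r0 Tt s0 sr] := sol_domP Up.
have [l1 l2 l3] := sol_dom_defined Up.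
have Tn : T - time p != 0 by rewrite gt_eqF.
have D1 : is_derive p w (fun p => ln (1 - p.2 / T)) (- (T - time p)^-1 * c).
  have D : is_derive p w (fun p => 1 - time p / T) (- T^-1 * c).
    by apply: is_derive_eq; rewrite /GRing.scale /=; ring.
  have := is_derive_ln_comp (h := fun p : V => 1 - p.2 / T) l1 D.
  rewrite -/(time p).
  rewrite (_ : (1 - time p / T)^-1 * _ = - (T - time p)^-1 * c) //.
  by field; rewrite Tn gt_eqF.
have D2 : is_derive p w
    (fun p => ln (Num.sqrt (1 + al) + (enorm p.1 - q) / (T - p.2)))
    ((a + (radius p - q) / (T - time p) * c) / gap p).
  have DV : is_derive p w (fun p => (T - time p)^-1) ((T - time p) ^- 2 * c).
    have DTt : is_derive p w (fun p => T - time p) (- c).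
      by apply: is_derive_eq; rewrite sub0r.
    by have := is_derive_inv_comp (h := fun p : V => T - time p) Tn DTt; rewrite mulrNN.
  have DN : is_derive p w (fun p => radius p - q) a.
    by apply: is_derive_eq; rewrite subr0.
  have DM := is_deriveM DN DV.
  have D : is_derive p w
      (fun p => Num.sqrt (1 + al) + (radius p - q) * (T - time p)^-1)
      (0 + ((radius p - q) *: ((T - time p) ^- 2 * c) + (T - time p)^-1 *: a)).
    by apply: is_deriveD; exact: DM.
  have [Dp DE] := is_derive_ln_comp (h := fun p : V =>
    Num.sqrt (1 + al) + (enorm p.1 - q) / (T - p.2)) l2 D.
  apply: DeriveDef; first exact: Dp.
  rewrite DE -/(time p) -/(radius p) bS /GRing.scale /=.
  rewrite (_ : b + _ = gap p / (T - time p)); last by rewrite /gap; field.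
  by field; rewrite Tn gt_eqF.
have D3 : is_derive p w (fun p => ln (enorm p.1 / q)) ((radius p)^-1 * a).
  have D : is_derive p w (fun p => radius p / q) (q^-1 * a).
    by apply: is_derive_eq; rewrite /GRing.scale /=; ring.
  have := is_derive_ln_comp (h := fun p : V => enorm p.1 / q) l3 D.
  rewrite -/(radius p).
  rewrite (_ : (radius p / q)^-1 * _ = (radius p)^-1 * a) //.
  by field; rewrite !gt_eqF.
have D4 : is_derive p w (fun p => correction (enorm p.1) p.2)
    (g (sigma p) * ((1 - sigma p) / radius p * a - b / radius p * c)).
  have [Df _ _] := fP sr.
  exact: is_derive_comp1 Df (is_derive_sigma r0 Da Dc).
have [Dv vE] := is_deriveD (is_deriveD (is_deriveB (is_deriveB
  (is_deriveZ (- al) D1) (is_deriveZ al D2)) (is_deriveZ ((n%:R - 1) / 2) D3)) D4)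
  (is_derive_cst kap p w).
apply: DeriveDef; first exact: Dv.
rewrite [LHS]vE /dr_sol /dt_sol /GRing.scale /=.
have gE : radius p - q = gap p - b * (T - time p) by rewrite /gap; ring.
by rewrite gE; field; rewrite Tn !gt_eqF.
Qed.

Definition drr_sol p : R :=
  al / gap p ^+ 2 + (n%:R - 1) / (2 * radius p ^+ 2)
  + dg (sigma p) * ((1 - sigma p) / radius p) ^+ 2
  - 2 * g (sigma p) * (1 - sigma p) / radius p ^+ 2.

Definition dtt_sol p : R :=
  al * b ^+ 2 / gap p ^+ 2 + b ^+ 2 * dg (sigma p) / radius p ^+ 2.

Lemma is_derive_dr_sol p w (a : R) : sol_dom p ->
  is_derive p w radius a -> is_derive p w time 0 ->
  is_derive p w dr_sol (drr_sol p * a).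
Proof.
move=> Up Da Dc; have [r0 Tt s0 sr] := sol_domP Up.
have rn0 : radius p != 0 by rewrite gt_eqF.
have sn0 : gap p != 0 by rewrite gt_eqF.
have DVs := is_derive_inv_comp sn0 (is_derive_gap Da Dc).
have DVr := is_derive_inv_comp rn0 Da.
have Dsig := is_derive_sigma r0 Da Dc.
have [_ Dg _] := fP sr; have DG := is_derive_comp1 Dg Dsig.
have D1s : is_derive p w (fun p => 1 - sigma p)
    (- ((1 - sigma p) / radius p * a - b / radius p * 0)).
  by apply: is_derive_eq; rewrite sub0r.
have [D DE] := is_deriveD (is_deriveB (is_deriveZ (- al) DVs)
  (is_deriveZ ((n%:R - 1) / 2) DVr)) (is_deriveM (is_deriveM DG D1s) DVr).
have -> : dr_sol = (- al) \*: (fun p => (gap p)^-1)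
   - ((n%:R - 1) / 2) \*: (fun p => (radius p)^-1)
   + (g \o sigma) * (fun p => 1 - sigma p) * (fun p => (radius p)^-1).
  apply/funext => x; rewrite /dr_sol !fctE /= /GRing.scale /= invfM; ring.
apply: DeriveDef; first exact: D.
rewrite [LHS]DE /drr_sol !fctE /= /GRing.scale /=.
by field; rewrite rn0.
Qed.

Lemma is_derive_dt_sol p w (c : R) : sol_dom p ->
  is_derive p w radius 0 -> is_derive p w time c ->
  is_derive p w dt_sol (dtt_sol p * c).
Proof.
move=> Up Da Dc; have [r0 Tt s0 sr] := sol_domP Up.
have rn0 : radius p != 0 by rewrite gt_eqF.
have sn0 : gap p != 0 by rewrite gt_eqF.
have DVs := is_derive_inv_comp sn0 (is_derive_gap Da Dc).
have DVr := is_derive_inv_comp rn0 Da.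
have Dsig := is_derive_sigma r0 Da Dc.
have [_ Dg _] := fP sr; have DG := is_derive_comp1 Dg Dsig.
have [D DE] := is_deriveB (is_deriveZ (al * b) DVs)
  (is_deriveZ b (is_deriveM DG DVr)).
have -> : dt_sol = (al * b) \*: (fun p => (gap p)^-1)
   - b \*: ((g \o sigma) * (fun p => (radius p)^-1)).
  apply/funext => x; rewrite /dt_sol !fctE /= /GRing.scale /=; ring.
apply: DeriveDef; first exact: D.
rewrite [LHS]DE /dtt_sol /= /GRing.scale /=.
by field; rewrite rn0.
Qed.

Lemma dt_blowup_sol p : sol_dom p -> dt v p = dt_sol p.
Proof.
move=> Up; have [r0 _ _ _] := Up.
have [_] := is_derive_sol Up (is_derive_radius_time r0) (is_derive_time p time_dir).
by rewrite mulr0 add0r mulr1.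
Qed.

Lemma dx_blowup_sol i p : sol_dom p ->
  dx i v p = dr_sol p * (coord i p / radius p).
Proof.
move=> Up; have [r0 _ _ _] := Up.
have [_] := is_derive_sol Up (is_derive_radius_space i r0)
  (is_derive_time p (space_dir R i)).
by rewrite mulr0 addr0.
Qed.

Lemma dtt_blowup_sol p : sol_dom p -> dt (dt v) p = dtt_sol p.
Proof.
move=> Up; have [r0 _ _ _] := Up.
rewrite /dt (derive_eq_open _ open_sol_dom (g := dt_sol)); last exact/mem_set.
  have [_] := is_derive_dt_sol Up (is_derive_radius_time r0)
    (is_derive_time p time_dir).
  by rewrite mulr1.
by move=> y /set_mem; exact: dt_blowup_sol.
Qed.

Lemma dxx_blowup_sol i p : sol_dom p ->
  dx i (dx i v) p = drr_sol p * (coord i p / radius p) ^+ 2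
    + dr_sol p * ((radius p)^-1 - coord i p ^+ 2 / radius p ^+ 3).
Proof.
move=> Up; have [r0 _ _ _] := Up; have rn0 : radius p != 0 by rewrite gt_eqF.
pose h p : R := dr_sol p * (coord i p / radius p).
rewrite {1}/dx (derive_eq_open _ open_sol_dom (g := h)); last exact/mem_set.
  have Dr := is_derive_radius_space i r0.
  have Dc : is_derive p (space_dir R i) (coord i) 1.
    by have := is_derive_coord p (space_dir R i) i; rewrite {2}/coord /= mxE !eqxx.
  have [_ DE] := is_deriveM (is_derive_dr_sol Up Dr (is_derive_time p (space_dir R i)))
    (is_deriveM Dc (is_derive_inv_comp rn0 Dr)).
  by rewrite [LHS]DE !fctE /GRing.scale /=; field.
by move=> y /set_mem; exact: dx_blowup_sol.
Qed.

Lemma blowup_sol_wave p : sol_dom p ->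
  dt (dt v) p - laplacian v p = grad_sq v p.
Proof.
move=> Up; have [r0 _ s0 _] := Up; have [_ _ _ sr] := sol_domP Up.
have rn0 : radius p != 0 by rewrite gt_eqF.
have sn0 : gap p != 0 by rewrite gt_eqF.
rewrite dtt_blowup_sol // /laplacian /grad_sq.
under eq_bigr do rewrite dxx_blowup_sol //.
under [in RHS]eq_bigr do rewrite dx_blowup_sol // exprMn expr_div_n.
rewrite big_split /= -[in RHS]mulr_sumr -[in RHS]mulr_suml -radius_sqr.
under eq_bigr do rewrite expr_div_n.
rewrite -!mulr_sumr -[X in drr_sol p * X]mulr_suml -radius_sqr.
rewrite sumrB sumr_const card_ord -mulr_suml -radius_sqr -mulr_natl.
have [_ _ ODE] := fP sr.
have alE : al = b ^+ 2 - 1 by rewrite bE; ring.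
have gapE : gap p = sigma p * radius p by rewrite /sigma; field.
have sgn0 : sigma p != 0 by rewrite mulf_neq0 // invr_eq0.
(* the residual is the ordinary equation divided by sigma r^2 *)
apply/eqP; rewrite -subr_eq0; apply/eqP.
move: ODE; rewrite /m /drr_sol /dr_sol /dtt_sol gapE alE.
set x := sigma p => ODE; rewrite -[RHS](mul0r (x * radius p ^+ 2)^-1) -[in RHS]ODE.
by field; rewrite rn0.
Qed.

Lemma blowup_sol_solves (A : set V) : A `<=` sol_dom ->
  [/\ well_defined_on A al T q, smooth_solution_on A v &
     smooth_initial_data_on A v].
Proof.
move=> AU; have oU := open_sol_dom.
have sv : smooth_on_open sol_dom v.
  by apply/smooth_on_openP => k; exact: Cn_blowup_sol.
have sdtv : smooth_on_open sol_dom (dt v).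
  apply/smooth_on_openP => k; have /smooth_on_openP/(_ k.+1)[_] := sv; exact.
split.
- by move=> p /AU; exact: sol_dom_defined.
- by split; [exists sol_dom|move=> p /AU; exact: blowup_sol_wave].
- by split; apply: (smooth_on_slice 0 oU).
Qed.

End blowup_solution.

(** * Estimates on the cone *)

Section cone_estimates.
Variable R : realType.
Implicit Types (b q T eps delta tau r C M K : R).

(** The bound [1 / (4 rad)] gives [|r - q| < q / 4], and
    [delta / (2 (b + rad))] bounds [sigma], since [s <= (b + rad) tau] and
    [q / 2 < r]. Positivity of [s] is [rad < b]: the cone opens more
    slowly than the singular line recedes from its axis. *)
Lemma cone_geometry b rad q T eps delta tau r :
  1 < b -> rad = (1 + b) / 2 -> 0 < q -> T / q < eps ->
  eps <= 1 / (4 * rad) -> eps <= delta / (2 * (b + rad)) ->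
  0 < tau <= T -> `|r - q| <= rad * tau ->
  [/\ q / 2 < r, 0 < b * tau + (r - q),
      (b * tau + (r - q)) / r <= 2 * (b + rad) * (tau / q),
      2 * (b + rad) * (tau / q) < delta & tau / q <= 1].
Proof.
move=> b1 radE q0 Te e1 e2 /andP[tau0 tauT]; rewrite ler_norml => /andP[rl ru].
have rad1 : 1 < rad by rewrite radE; lra.
have radb : rad < b by rewrite radE; lra.
have y0 : 0 < tau / q by rewrite divr_gt0.
have yT : tau / q <= T / q by rewrite ler_pM2r // invr_gt0.
have ye : tau / q < eps by apply: le_lt_trans Te.
have y4 : (tau / q) * (4 * rad) < 1.
  by rewrite -ltr_pdivlMr ?(lt_le_trans ye) // mulr_gt0 //; lra.
have yd : (tau / q) * (2 * (b + rad)) < delta.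
  by rewrite -ltr_pdivlMr ?(lt_le_trans ye) // mulr_gt0 //; lra.
have tauE : tau = tau / q * q by field; rewrite gt_eqF.
have qr : rad * tau * 4 < q.
  rewrite (_ : _ * 4 = (tau / q * (4 * rad)) * q) ?gtr_pMl //.
  by field; rewrite gt_eqF.
have tr : rad * tau < b * tau by rewrite ltr_pM2r.
have rq : q / 2 < r by lra.
have r0 : 0 < r by apply: lt_trans rq; rewrite divr_gt0.
split=> //; first by lra.
- rewrite ler_pdivrMr //.
  apply: (@le_trans _ _ (2 * (b + rad) * (tau / q) * (q / 2))).
    by rewrite (_ : _ * (q / 2) = b * tau + rad * tau); [lra|field; rewrite gt_eqF].
  have k0 : 0 <= 2 * (b + rad) by lra.
  by rewrite ler_wpM2l ?(ltW rq) // (mulr_ge0 k0 (ltW y0)).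
- by rewrite mulrC.
- apply: ltW; apply: le_lt_trans y4; rewrite ler_peMr ?(ltW y0) //; lra.
Qed.

(** With [y = tau / q], both [tau / r] and [x] are bounded by multiples of
    [y], so [tau^i r^-i H x] is of order [y^i y^(2-i)], and this is at most
    [y^2] because [y <= 1] (the subtraction [2 - i] is truncated). *)
Lemma pointwise_decay (H : R -> R) (i : nat) (kappa q tau r x C : R) :
  1 <= kappa -> 0 < q -> 0 < tau -> tau / q <= 1 -> q / 2 < r ->
  0 <= x <= kappa * (tau / q) -> 0 <= C -> `|H x| <= C * `|x| ^+ (2 - i) ->
  `|r ^- i * H x| <= C * 2 ^+ i * kappa ^+ 2 * (tau / q) ^+ 2 / tau ^+ i.
Proof.
move=> k1 q0 tau0 y1 qr /andP[x0 xk] C0 Hx.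
have r0 : 0 < r by apply: lt_trans qr; rewrite divr_gt0.
have k0 : 0 <= kappa by apply: le_trans k1.
set y := tau / q in y1 xk *; have y0 : 0 < y by rewrite divr_gt0.
rewrite ler_pdivlMr ?exprn_gt0 // normrM.
rewrite ger0_norm ?invr_ge0 ?exprn_ge0 ?(ltW r0) //.
rewrite mulrAC -[_^-1 * _]mulrC -expr_div_n mulrC.
have tr0 : 0 <= tau / r by rewrite divr_ge0 ?(ltW tau0) ?(ltW r0).
have y20 : 0 <= 2 * y by rewrite mulr_ge0 // ltW.
have tr : (tau / r) ^+ i <= (2 * y) ^+ i.
  apply: lerXn2r; rewrite ?nnegrE // ler_pdivrMr // (_ : tau = 2 * y * (q / 2)).
    by rewrite ler_wpM2l ?(ltW qr).
  by rewrite /y; field; rewrite gt_eqF.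
have Hx' : `|H x| <= C * (kappa ^+ 2 * y ^+ (2 - i)).
  apply: (le_trans Hx); rewrite ler_wpM2l // ger0_norm //.
  apply: (@le_trans _ _ ((kappa * y) ^+ (2 - i))).
    by rewrite lerXn2r ?nnegrE // mulr_ge0 // ltW.
  rewrite exprMn ler_wpM2r ?exprn_ge0 ?(ltW y0) //.
  by rewrite ler_weXn2l // leq_subr.
apply: (@le_trans _ _ (C * (kappa ^+ 2 * y ^+ (2 - i)) * (2 * y) ^+ i)).
  by apply: ler_pM => //; rewrite exprn_ge0.
rewrite [(2 * y) ^+ i]exprMn.
rewrite (_ : C * _ * _ = C * 2 ^+ i * kappa ^+ 2 * (y ^+ (2 - i) * y ^+ i)).
  rewrite ler_wpM2l ?mulr_ge0 ?exprn_ge0 // -exprD.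
  by apply: ler_wiXn2l; rewrite ?(ltW y0) // addnC -leq_subLR.
by ring.
Qed.

(** The interval has length [2 rad tau], and its square root cancels the
    factor [tau^(-1/2)]. *)
Lemma weighted_L2norm_le (F : R -> R) (i : nat) (a q rad tau K : R) :
  0 < rad -> 0 < tau -> 0 <= K -> a = - (1 / 2) + i%:R ->
  (forall r, rball q (rad * tau) r -> `|F r| <= K / tau ^+ i) ->
  ((tau `^ a)%:E * L2norm (rball q (rad * tau)) F
     <= (K * (2 * rad) `^ (1 / 2))%:E)%E.
Proof.
move=> rad0 tau0 K0 aE FK.
have K1 : 0 <= K / tau ^+ i by rewrite mulr_ge0 // invr_ge0 exprn_ge0 // ltW.
have L := L2norm_rball_le (mulr_gt0 rad0 tau0) K1 FK.
apply: (@le_trans _ _ ((tau `^ a)%:E *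
    (K / tau ^+ i * (2 * (rad * tau)) `^ (1 / 2))%:E)%E).
  apply: lee_wpmul2l; first by rewrite lee_fin powR_ge0.
  exact: L.
rewrite -EFinM lee_fin aE powRD; last by rewrite (gt_eqF tau0) implybT.
rewrite powR_mulrn ?(ltW tau0) // powRN [2 * (rad * _)]mulrA.
rewrite powRM ?mulr_ge0 ?(ltW rad0) ?(ltW tau0) //.
have tn : tau `^ (1 / 2) != 0 by rewrite gt_eqF // powR_gt0.
have ti : tau ^+ i != 0 by rewrite expf_neq0 // gt_eqF.
set X := tau `^ _ in tn *; set Y := tau ^+ i in ti *; set Z := (2 * rad) `^ _.
have -> : X^-1 * Y * (K / Y * (Z * X)) = K * Z by field; rewrite tn ti.
  exact: lexx.
Qed.

Lemma decay_rate_le (q T t w : R) : 0 < q -> 0 <= t < T -> 0 <= w <= 2 ->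
  ((T - t) / q) ^+ 2 <= (T / q) ^+ 2 * (1 - t / T) `^ w.
Proof.
move=> q0 /andP[t0 tT] /andP[w0 w2]; have T0 : 0 < T by apply: le_lt_trans tT.
have -> : (T - t) / q = T / q * (1 - t / T) by field; rewrite !gt_eqF.
have z0 : 0 < 1 - t / T by rewrite subr_gt0 ltr_pdivrMr // mul1r.
rewrite exprMn ler_wpM2l ?sqr_ge0 // -powR_mulrn ?(ltW z0) //.
by rewrite ger_powR // z0 gerBl divr_ge0 // ltW.
Qed.

End cone_estimates.

(** * The blow-up family *)

Section correction_derivatives.
Variables (R : realType) (b q T rho : R) (f g : R -> R).
Hypothesis Cf : forall k, Cn k [set x : R | `|x| < rho] f.
Hypothesis Df : forall x : R, `|x| < rho -> is_derive x 1 f (g x).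

Lemma dr_correction j (r t : R) : flow_dom (b * (T - t)) q rho r ->
  dr_iter j (correction b q T f) r t =
    r ^- j * profile_dr 0 j f (flow_ratio (b * (T - t)) q r).
Proof.
move=> rD; rewrite /dr_iter (derive1n_profile j Cf (c := 0) _ rD) // => r' _.
by rewrite expr0 invr1 mul1r.
Qed.

(** This has the same shape [r^-c h (sigma)] as the correction, now with
    [c = 1] and [h = - b g], because [d sigma / dt = - b / r]. *)
Lemma dt_correction (r t : R) : flow_dom (b * (T - t)) q rho r ->
  dt_radial (correction b q T f) r t =
    (r ^+ 1)^-1 * (- b * g (flow_ratio (b * (T - t)) q r)).
Proof.
move=> rD; rewrite /dt_radial derive1E.
have Dfl : is_derive t 1 (fun t' => flow_ratio (b * (T - t')) q r) (- b / r).
  by rewrite /flow_ratio; apply: is_derive_eq; rewrite /GRing.scale /=; ring.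
have [_ ->] := @is_derive_comp1 _ _ f (fun t' => flow_ratio (b * (T - t')) q r)
  t 1 _ _ (Df (flow_ratio_dom rD)) Dfl.
by rewrite expr1; ring.
Qed.

Lemma dr_dt_correction j (r t : R) : flow_dom (b * (T - t)) q rho r ->
  dr_iter j (dt_radial (correction b q T f)) r t =
    r ^- j.+1 * profile_dr 1 j (fun x => - b * g x) (flow_ratio (b * (T - t)) q r).
Proof.
move=> rD; have oU := @open_norm_lt R rho.
have Cg k : Cn k [set x : R | `|x| < rho] (fun x => - b * g x).
  apply: (CnM oU); first exact: Cn_cst.
  have [_ CD] := Cf k.+1; apply: (Cn_eq oU) (CD 1) => x /set_mem Ux.
  by have [_ ->] := Df Ux.
rewrite /dr_iter (derive1n_profile j Cg (c := 1) _ rD) // => r' r'D.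
exact: dt_correction.
Qed.

End correction_derivatives.

Section cone_inclusions.
Variables (R : realType) (n : nat).
Implicit Types (al b q T rho : R).

Lemma sqrt_speed al : 0 < al ->
  Num.sqrt (1 + al) ^+ 2 = 1 + al /\ 1 < Num.sqrt (1 + al).
Proof.
move=> al0; split; first by rewrite sqr_sqrtr // addr_ge0 // ltW.
by rewrite -[X in X < _]sqrtr1 ltr_sqrt ?ltrDl // addr_gt0.
Qed.

(** On the cone [q - T <= r] and [s <= (b + 1) T], which bounds [sigma]. *)
Lemma light_cone_sub b q T : 1 < b -> 0 < T -> T < q ->
  @cone R n 1 q T `<=` sol_dom b q T ((b + 1) * T / (q - T) + 1).
Proof.
move=> b1 T0 Tq p [/andP[t0 tT]]; rewrite mul1r ler_norml => /andP[rl ru].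
have bt : 0 < (b - 1) * (T - p.2) by rewrite mulr_gt0 //; lra.
have bt' : 0 <= (b + 1) * p.2 by rewrite mulr_ge0 //; lra.
have s0 : 0 < gap b q T p by rewrite /gap /radius /time; lra.
have qT : 0 < q - T by lra.
have c0 : 0 <= (b + 1) * T / (q - T).
  by apply: divr_ge0; [apply: mulr_ge0; lra|lra].
have r0 : 0 < enorm p.1 by lra.
set c := _ / (q - T) in c0 *.
have cE : (b + 1) * T = c * (q - T) by rewrite /c; field; rewrite gt_eqF.
have : (b + 1) * T <= c * enorm p.1 by rewrite cE ler_wpM2l //; lra.
by move=> H; split=> //; rewrite gtr0_norm // /gap /radius /time; lra.
Qed.

End cone_inclusions.

Theorem theorem1p1 (R : realType) :
  (forall (n : nat) (omega0 alpha0 : R) (k : nat) (gamma : R),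
    (2 <= n)%N -> 0 < omega0 < 1 -> 0 < alpha0 ->
    Num.ceil (calpha alpha0) + 1 <= k%:Z ->
    0 < gamma < omega0 ->
    exists2 C : R, 0 < C &
    forall r0 : R, 0 < r0 ->
    exists2 epsilon : R, 0 < epsilon < 1 / (2 * Ralpha alpha0) &
    forall T0 : R, 0 < T0 -> 0 < T0 / r0 < epsilon ->
    exists zeta : R -> R -> R,
      let omega := omega0 - gamma in
      let A := @cone R n (Ralpha alpha0) r0 T0 in
      [/\ forall t : R, 0 <= t < T0 ->
            let B := rball r0 (Ralpha alpha0 * (T0 - t)) in
            (forall j : nat, (j <= k + 1)%N ->
              (((T0 - t) `^ (- (1 / 2) + j%:R))%:E
                 * L2norm B (fun r => dr_iter j zeta r t)
               <= (C * ((T0 / r0) ^+ 2 * (1 - t / T0) `^ omega))%:E)%E)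
            /\
            (forall j : nat, (j <= k)%N ->
              (((T0 - t) `^ (1 / 2 + j%:R))%:E
                 * L2norm B (fun r => dr_iter j (dt_radial zeta) r t)
               <= (C * ((T0 / r0) ^+ 2 * (1 - t / T0) `^ omega))%:E)%E),
          well_defined_on A alpha0 T0 r0,
          forall kappa0 : R,
            let v := @blowup_sol R n alpha0 kappa0 T0 r0 zeta in
            smooth_solution_on A v /\ smooth_initial_data_on A v &
          n = 3%N -> forall r t : R, zeta r t = 0])
  /\
  (forall alpha0 r0 T0 kappa0 : R,
    0 < alpha0 -> 0 < r0 -> 0 < T0 -> T0 / r0 < 1 ->
    let v3 := fun p : 'rV[R]_3 * R =>
      - alpha0 * ln (1 - p.2 / T0)
      - alpha0 * ln (Num.sqrt (1 + alpha0) + (enorm p.1 - r0) / (T0 - p.2))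
      - ln (enorm p.1 / r0) + kappa0 in
    let A := @cone R 3 1 r0 T0 in
    [/\ forall p, @blowup_sol R 3 alpha0 kappa0 T0 r0 (fun _ _ => 0) p = v3 p,
        well_defined_on A alpha0 T0 r0,
        smooth_solution_on A v3 &
        smooth_initial_data_on A v3]).
Proof.
split; last first.
  move=> al q T kap al0 q0 T0 Tq v3 A; have [bE b1] := sqrt_speed al0.
  have TltQ : T < q by rewrite -[q]mul1r -ltr_pdivrMr.
  have vE p : @blowup_sol R 3 al kap T q (fun _ _ => 0) p = v3 p.
    by rewrite /blowup_sol /v3; field.
  have v3E : v3 = @blowup_sol R 3 al kap T q
      (correction (Num.sqrt (1 + al)) q T (fun=> 0)) by apply/funext => p; rewrite -vE.
  have ODE0 (rho : R) (x : R) : `|x| < rho ->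
      [/\ is_derive x 1 (fun=> 0 : R) ((fun=> 0) x),
          is_derive x 1 (fun=> 0 : R) ((fun=> 0) x) &
          x * (al + 2 * x - x ^+ 2) * (fun=> 0) x
          + 2 * (1 - x) * (x + al) * (fun=> 0) x
          - x * (1 - x) ^+ 2 * (fun=> 0) x ^+ 2
          + (3%:R - 1) * (3%:R - 3) / 4 * x = 0].
    by move=> _; split; [exact: is_derive_cst|exact: is_derive_cst|ring].
  have C0 rho k : Cn k [set x : R | `|x| < rho] (fun=> 0).
    by apply: Cn_cst; exact: open_norm_lt.
  have [W S I] := blowup_sol_solves kap bE erefl q0 T0 (C0 _) (@ODE0 _)
    (light_cone_sub b1 T0 TltQ).
  by rewrite v3E; split=> // p; rewrite -v3E.
move=> n om0 al k gam _ om01 al0 _ gamP; have [bE b1] := sqrt_speed al0.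
set b := Num.sqrt (1 + al) in bE b1; pose rad := Ralpha al.
have radE : rad = (1 + b) / 2 by [].
have rad1 : 1 < rad by rewrite radE; lra.
have radb : rad < b by rewrite radE; lra.
have [rho [f [g [dg [rho0 Cf fP [f0 g0] fm0]]]]] :=
  correction_profile ((n%:R - 1) * (n%:R - 3) / 4) al0.
have Df (x : R) : `|x| < rho -> is_derive x 1 f (g x) by move=> /fP[].
(* gb is the profile of the time derivative of the correction *)
pose fb x := - b * f x; pose gb x := - b * g x.
have oU := @open_norm_lt R rho.
have Cfb i : Cn i [set x : R | `|x| < rho] fb.
  by apply: (CnM oU) (Cf i); exact: Cn_cst.
have Dfb (x : R) : `|x| < rho -> is_derive x 1 fb (gb x).
  move=> /Df D; have [Dd DE] := is_deriveZ (- b) D.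
  by apply: DeriveDef; [exact: Dd|exact: DE].
have fb0 : fb 0 = 0 by rewrite /fb f0 mulr0.
have gb0 : gb 0 = 0 by rewrite /gb g0 mulr0.
have H0 j := profile_dr_order j rho0 Cf Df f0 g0 (leq0n 1).
have H1 j := profile_dr_order j rho0 Cfb Dfb fb0 gb0 (leqnn 1).
have [d0 [C0 [d00 C00 B0]]] := @common_order R (fun j => 2 - (0 + j))%N
  (fun j => profile_dr 0 j f) H0 (k + 1)%N.
have [d1 [C1 [d10 C10 B1]]] := @common_order R (fun j => 2 - (1 + j))%N
  (fun j => profile_dr 1 j gb) H1 k.
pose kappa := 2 * (b + rad); pose delta := Num.min rho (Num.min d0 d1).
have kappa1 : 1 <= kappa by rewrite /kappa; lra.
have delta0 : 0 < delta by rewrite !lt_min rho0 d00.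
have [delta_rho [delta_d0 delta_d1]] : delta <= rho /\ delta <= d0 /\ delta <= d1.
  by rewrite /delta !ge_min !lexx !orbT.
pose K := (C0 + C1) * 2 ^+ (k + 1) * kappa ^+ 2.
have kappa0 : 0 < kappa by apply: lt_le_trans kappa1.
have K0 : 0 < K by rewrite /K mulr_gt0 ?exprn_gt0 // mulr_gt0 ?exprn_gt0 ?addr_gt0.
exists (K * (2 * rad) `^ (1 / 2)).
  by rewrite mulr_gt0 // powR_gt0 // mulr_gt0 //; lra.
move=> q q0; pose eps := Num.min (1 / (4 * rad)) (delta / kappa).
have eps0 : 0 < eps.
  by rewrite lt_min (divr_gt0 delta0 kappa0) divr_gt0 // mulr_gt0 //; lra.
have eps1 : eps <= 1 / (4 * rad) by rewrite ge_min lexx.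
have eps2 : eps <= delta / (2 * (b + rad)) by rewrite ge_min lexx orbT.
exists eps.
  rewrite eps0 /=; apply: (le_lt_trans eps1).
  rewrite -/rad ltr_pdivlMr ?mulr_gt0 ?(lt_trans _ rad1) //.
  by rewrite mul1r mulrC ltr_pdivrMr; lra.
move=> T T0 /andP[_ Te]; exists (correction b q T f).
have om2 : 0 <= om0 - gam <= 2 by lra.
have geo t r : 0 <= t < T -> `|r - q| <= rad * (T - t) ->
    [/\ q / 2 < r, 0 < b * (T - t) + (r - q),
        flow_ratio (b * (T - t)) q r <= kappa * ((T - t) / q),
        kappa * ((T - t) / q) < delta & (T - t) / q <= 1].
  move=> /andP[t0 tT] rq; apply: cone_geometry b1 radE q0 Te eps1 eps2 _ rq.
  by rewrite subr_gt0 tT gerBl.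
have geoD t r : 0 <= t < T -> `|r - q| <= rad * (T - t) ->
    [/\ 0 < r, 0 < flow_ratio (b * (T - t)) q r,
        flow_ratio (b * (T - t)) q r < delta &
        flow_dom (b * (T - t)) q rho r].
  move=> tT rq; have [rq2 s0 sk kd _] := geo t r tT rq.
  have r0 : 0 < r by apply: lt_trans rq2; rewrite divr_gt0.
  split=> //; first by rewrite divr_gt0.
    exact: le_lt_trans sk kd.
  split=> //; rewrite gtr0_norm // -ltr_pdivrMr //.
  exact: lt_le_trans (le_lt_trans sk kd) delta_rho.
have est i (a t : R) (H F : R -> R) : (i <= k + 1)%N -> 0 <= t < T ->
    a = - (1 / 2) + i%:R -> bounded_order (2 - i) H delta (C0 + C1) ->
    (forall r, flow_dom (b * (T - t)) q rho r ->
      F r = r ^- i * H (flow_ratio (b * (T - t)) q r)) ->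
    (((T - t) `^ a)%:E * L2norm (rball q (rad * (T - t))) F <=
      (K * (2 * rad) `^ (1 / 2) *
        ((T / q) ^+ 2 * (1 - t / T) `^ (om0 - gam)))%:E)%E.
  move=> ik tT aE HB FE; have tau0 : 0 < T - t by rewrite subr_gt0; case/andP: tT.
  pose K' := K * ((T - t) / q) ^+ 2.
  apply: (@le_trans _ _ (K' * (2 * rad) `^ (1 / 2))%:E).
    apply: (weighted_L2norm_le (i := i)) => //.
    - by apply: lt_trans rad1.
    - by rewrite mulr_ge0 ?sqr_ge0 // ltW.
    move=> r; rewrite /rball /= in_itv /= => /andP[rl ru].
    have rq : `|r - q| <= rad * (T - t).
      by rewrite ler_norml; apply/andP; split; lra.
    have [rq2 _ sk kd y1] := geo t r tT rq; have [r0 s0 sd rD] := geoD t r tT rq.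
    rewrite FE //; apply: (@le_trans _ _
        ((C0 + C1) * 2 ^+ i * kappa ^+ 2 * ((T - t) / q) ^+ 2 / (T - t) ^+ i)).
      apply: (pointwise_decay (r := r)) kappa1 q0 tau0 y1 rq2 _ _ _.
      + by rewrite (ltW s0).
      + by rewrite addr_ge0 // ltW.
      + by apply: HB; rewrite gtr0_norm.
    rewrite ler_pM2r ?invr_gt0 ?exprn_gt0 // /K' /K ler_wpM2r ?sqr_ge0 //.
    rewrite ler_wpM2r ?sqr_ge0 // ler_wpM2l ?addr_ge0 ?(ltW C00) ?(ltW C10) //.
    by rewrite ler_weXn2l // ler1n.
  have KZ : 0 <= K * (2 * rad) `^ (1 / 2).
    exact: mulr_ge0 (ltW K0) (powR_ge0 _ _).
  by rewrite lee_fin /K' mulrAC (ler_wpM2l KZ) // decay_rate_le.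
have CT : @cone R n rad q T `<=` sol_dom b q T rho.
  move=> p [tT rq]; have [r0 s0 _ [_ rD]] := geoD _ _ tT rq.
  split=> //; first by case/andP: tT.
  by move: s0; rewrite /flow_ratio pmulr_lgt0 ?invr_gt0.
have sol kap := blowup_sol_solves kap bE erefl q0 T0 Cf fP CT.
split; last by move=> n3 r t; rewrite /correction fm0 // n3 subrr mulr0 mul0r.
- move=> t tT; split=> j jk.
    apply: (est j _ t (profile_dr 0 j f)) => //.
      by apply: bounded_orderW (B0 j jk) => //; rewrite lerDl ltW.
    by move=> r rD; exact: (dr_correction Cf j rD).
  apply: (est j.+1 _ t (profile_dr 1 j gb)) => //.
  + by rewrite addn1.
  + by rewrite -natr1; field.
  + by apply: bounded_orderW (B1 j jk) => //; rewrite lerDr ltW.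
  + by move=> r rD; exact: (dr_dt_correction Cf Df j rD).
- by have [] := sol 0.
- by move=> kap; have [] := sol kap.
Qed.
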